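(* Let $h\in(0,1)$ and $K\in C^h([0,T])$, let $K_n$ be the Bernstein polynomial approximation of $K$ of order $n$, and let $u\in L^2_a$. Let $X^u$ and $X^u_n$ be the solutions of $$X^u(t)=X(0)+\int_0^tK(t-s)(\alpha u(s)-\beta X^u(s))ds+\sigma\int_0^tK(t-s)dW(s),$$ $$X^u_n(t)=X(0)+\int_0^tK_n(t-s)(\alpha u(s)-\beta X^u_n(s))ds+\sigma\int_0^tK_n(t-s)dW(s),\quad t\in[0,T].$$ Then there exists $C>0$, not depending on $n$ or $u$, such that for any $u\in L^2_a$, $$\sup_{t\in[0,T]}\mathbb E\big[|X^u(t)-X^u_n(t)|^2\big]\le C(1+\|u\|_2^2)n^{-h}.$$
   Context: Fix $T>0$ and constants $\alpha,\beta,\sigma>0$, $X(0)\in\mathbb R$. $W$ is a standard one-dimensional Brownian motion; $L^2_a$ is the space of real-valued square-integrable processes on $\Omega\times[0,T]$ adapted to the filtration generated by $W$; $\|\cdot\|_2$ is the $L^2(\Omega\times[0,T])$ norm. $C^h([0,T])$ is the set of $h$-Hölder continuous functions on $[0,T]$. The Bernstein polynomial approximation of order $n$ of $K$ is $K_n(t)=\frac{1}{T^n}\sum_{k=0}^nK\big(\frac{Tk}{n}\big)\binom nk t^k(T-t)^{n-k}$, $t\in[0,T]$. *)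

(* Defs.v *)
From HB Require Import structures.
From mathcomp Require Import all_boot all_order all_algebra.
From mathcomp Require Import all_classical all_reals all_analysis.
From mathcomp Require Import normal_distribution.
Set Implicit Arguments. Unset Strict Implicit. Unset Printing Implicit Defensive.
Import Order.TTheory GRing.Theory Num.Theory.
Import numFieldNormedType.Exports.
Local Open Scope classical_set_scope.
Local Open Scope ring_scope.

Section Defs.
Context {R : realType} {d : measure_display} {Omega : measurableType d}.

Definition brownian_motion (P : probability Omega R) (W : R -> Omega -> R) :=
  [/\ (forall t, 0 <= t -> measurable_fun setT (W t)),
      {ae P, forall w, W 0 w = 0 /\ {in `[0, +oo[, continuous (W ^~ w)}},
      (forall s t, 0 <= s -> s < t -> forall B, measurable B ->
         P [set w | W t w - W s w \in B] = normal_prob 0 (Num.sqrt (t - s)) B) &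
      (forall (n : nat) (tt : nat -> R), 0 <= tt 0%N ->
         (forall i, (i < n)%N -> tt i < tt i.+1) ->
         forall B : nat -> set R, (forall i, measurable (B i)) ->
         P (\bigcap_(i in [set i | (i < n)%N])
              [set w | W (tt i.+1) w - W (tt i) w \in B i])
         = \big[*%E/1%E]_(i < n) P [set w | W (tt i.+1) w - W (tt i) w \in B i])].

Definition nat_filtration (W : R -> Omega -> R) (t : R) : set (set Omega) :=
  <<s [set A | exists s B, [/\ 0 <= s <= t, measurable B & A = W s @^-1` B]] >>.

Definition L2a (P : probability Omega R) (W : R -> Omega -> R) (T : R)
    (u : R -> Omega -> R) :=
  [/\ measurable_fun (`[0, T] `*` setT) (fun p : R * Omega => u p.1 p.2),
      (forall t, 0 <= t <= T -> forall B, measurable B ->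
         nat_filtration W t (u t @^-1` B)) &
      (\int[P]_w \int[lebesgue_measure]_(s in `[0%R, T]) ((u s w) ^+ 2)%:E
         < +oo)%E].

Definition L2norm2 (P : probability Omega R) (T : R) (u : R -> Omega -> R)
  : \bar R :=
  (\int[P]_w \int[lebesgue_measure]_(s in `[0%R, T]) ((u s w) ^+ 2)%:E)%E.

(* Wiener integral I = int_0^t f(s) dW(s) for a deterministic continuous f:
   L^2(P)-limit of the left-point Riemann sums on uniform partitions. *)
Definition wiener_integral (P : probability Omega R) (W : R -> Omega -> R)
    (f : R -> R) (t : R) (I : Omega -> R) :=
  measurable_fun setT I /\
  (fun m : nat => (\int[P]_w
     ((\sum_(i < m) f (t * i%:R / m%:R) *
        (W (t * i.+1%:R / m%:R) w - W (t * i%:R / m%:R) w) - I w) ^+ 2)%:E)%E)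
    @ \oo --> 0%E.
End Defs.

Definition holder_on {R : realType} (T h : R) (K : R -> R) :=
  exists L : R, forall x y, 0 <= x <= T -> 0 <= y <= T ->
    `|K x - K y| <= L * (`|x - y| `^ h).

Definition bernstein {R : realType} (T : R) (K : R -> R) (n : nat) (t : R) : R :=
  (T ^+ n)^-1 * \sum_(k < n.+1)
     K (T * k%:R / n%:R) * 'C(n, k)%:R * t ^+ k * (T - t) ^+ (n - k).

Definition volterra_solution {R : realType} {d : measure_display}
    {Omega : measurableType d} (P : probability Omega R) (W : R -> Omega -> R)
    (T alpha beta sigma X0 : R) (G : R -> R) (u X : R -> Omega -> R) :=
  L2a P W T X /\
  forall t, 0 <= t <= T ->
    exists I : Omega -> R, wiener_integral P W (fun s => G (t - s)) t I /\
    {ae P, forall w, X t w = X0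
        + Rintegral lebesgue_measure `[0, t]
            (fun s => G (t - s) * (alpha * u s w - beta * X s w))
        + sigma * I w}.

(* Main.v *)
(* Gronwall's inequality is applied to second moments twice: to X^u, which gives
   a bound in terms of the norm of u, and then to X^u - X^u_n, whose forcing term
   is governed by eps := sup |K - K_n|.  The drift part is handled pathwise by
   Cauchy-Schwarz, the noise part by the fact that the Wiener integral of a
   kernel bounded by eps has second moment O(eps^2).  Finally eps = O(n^(-h/2)),
   because K_n(t) is the mean of K over a binomial distribution of variance
   O(1/n) and |x|^h <= n^(-h/2) (1 + n x^2). *)
Require Import Defs.
From HB Require Import structures.
From mathcomp Require Import all_boot all_order all_algebra.
From mathcomp Require Import all_classical all_reals all_analysis.
From mathcomp Require Import measurable_realfun normal_distribution.
From mathcomp Require Import ring lra.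
Set Implicit Arguments.
Unset Strict Implicit.
Unset Printing Implicit Defensive.
Import Order.TTheory GRing.Theory Num.Theory.
Import numFieldNormedType.Exports.
Local Open Scope classical_set_scope.
Local Open Scope ring_scope.

(** * Bernstein approximation of Hoelder functions *)

(** The drifts are compared through [K v - K_n z = (K - K_n) v - beta K_n (X - X_n)], where
    [v = alpha u - beta X] and [z = alpha u - beta X_n]. The forcing then contains [X] but not
    [X_n], which is why a moment bound for [X] alone precedes the comparison. Constants are uniform
    in [n] because one [M] bounds [K] and every [K_n] with [n >= 1]; they depend on [u] only
    linearly in [1 + |u|^2]; and [eps] enters squared, so [n^(-h/2)] becomes [n^(-h)]. The equation
    holds for each fixed [t] off a null set that may depend on [t], so the inequality at [t] is
    integrated over [Omega] before Gronwall is applied. A Wiener integral is given only as an [L^2]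
    limit of Riemann sums, so its bounds are proved for the sums, uniformly in the mesh, and passed
    to the limit at the cost of a factor 3. *)

Section binomial_mean.
Context {R : realType}.
Implicit Types (a b c : R) (f g : nat -> R).

(** For [a + b = 1] this is the expectation of [f] under the binomial law with success probability
    [a]; with [a] and [b] unrelated, the recursion below is a polynomial identity. *)
Definition binom_mean a b n f : R :=
  \sum_(k < n.+1) 'C(n, k)%:R * a ^+ k * b ^+ (n - k) * f k.

(** Pascal's rule, that is, conditioning on the outcome of one trial. It drives the inductions for
    the mean of a constant and of a square. *)
Lemma binom_meanS a b n f :
  binom_mean a b n.+1 f = a * binom_mean a b n (f \o S) + b * binom_mean a b n f.
Proof.
rewrite /binom_mean big_ord_recl/= bin0 subn0 !mulr_sumr.
under eq_bigr do rewrite binS natrD !mulrDl.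
rewrite big_split/= addrA addrC; congr (_ + _).
  apply: eq_bigr => i _; rewrite /= /bump/= add1n subSS exprS; ring.
rewrite big_ord_recr/= bin_small// !mul0r addr0 [RHS]big_ord_recl/= bin0 subn0.
congr (_ + _).
  by rewrite exprS; ring.
apply: eq_bigr => i _; rewrite /= /bump/= add1n subSS.
have -> : (n - i = (n - i.+1).+1)%N by rewrite subnSK.
rewrite !exprS; ring.
Qed.

Lemma binom_mean_cst a b c n : a + b = 1 -> binom_mean a b n (fun=> c) = c.
Proof.
move=> ab; elim: n => [|n IH]; first by rewrite /binom_mean big_ord1/= bin0 subnn !expr0; ring.
by rewrite binom_meanS/= IH -mulrDl ab mul1r.
Qed.

(** Variance plus squared bias. The centre [c] stays arbitrary because a success in one trial shifts
    it to [c - 1] in the induction. *)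
Lemma binom_mean_sqr a b n c : a + b = 1 ->
  binom_mean a b n (fun k => (k%:R - c) ^+ 2) = n%:R * a * b + (n%:R * a - c) ^+ 2.
Proof.
move=> ab; have {ab}-> : b = 1 - a by rewrite -ab addrAC subrr add0r.
elim: n c => [|n IH] c; first by rewrite /binom_mean big_ord1/= bin0 subnn !expr0; ring.
rewrite binom_meanS IH.
have -> : (fun k : nat => (k%:R - c) ^+ 2) \o S = fun k => (k%:R - (c - 1)) ^+ 2.
  by apply/funext => k /=; rewrite -natr1; ring.
rewrite IH -natr1; ring.
Qed.

Lemma le_binom_mean a b n f g : 0 <= a -> 0 <= b ->
  (forall k, (k <= n)%N -> f k <= g k) -> binom_mean a b n f <= binom_mean a b n g.
Proof.
move=> a0 b0 fg; apply: ler_sum => i _; apply: ler_wpM2l; last by rewrite fg// -ltnS.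
by rewrite !mulr_ge0// exprn_ge0.
Qed.

Lemma binom_meanD a b n f g :
  binom_mean a b n (fun k => f k + g k) = binom_mean a b n f + binom_mean a b n g.
Proof. by rewrite -big_split; apply: eq_bigr => i _; rewrite mulrDr. Qed.

Lemma binom_meanZ a b n c f :
  binom_mean a b n (fun k => c * f k) = c * binom_mean a b n f.
Proof. by rewrite mulr_sumr; apply: eq_bigr => i _; rewrite mulrCA. Qed.

Lemma ler_norm_binom_mean a b n f : 0 <= a -> 0 <= b ->
  `|binom_mean a b n f| <= binom_mean a b n (fun k => `|f k|).
Proof.
move=> a0 b0; apply: (le_trans (ler_norm_sum _ _ _)); apply: ler_sum => i _.
by rewrite normrM ger0_norm// !mulr_ge0// exprn_ge0.
Qed.

End binomial_mean.

Section bernstein_error.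
Context {R : realType}.

Lemma bernsteinE (T : R) (K : R -> R) (n : nat) (t : R) : T != 0 ->
  bernstein T K n t =
  binom_mean (t / T) ((T - t) / T) n (fun k => K (T * k%:R / n%:R)).
Proof.
move=> T0; rewrite /bernstein mulr_sumr; apply: eq_bigr => -[k /=].
rewrite ltnS => kn _; rewrite !expr_div_n -[in T ^+ n](subnK kn) exprD.
by field; rewrite !expf_neq0.
Qed.

(** The weight is tuned to [|x| = n^(-1/2)], the scale of the binomial fluctuations: with
    [y = n x^2] the claim becomes [y^(h/2) <= 1 + y], and that power is at most 1 or at most [y]. *)
Lemma powR_le_sqr (h x : R) (n : nat) : 0 <= h <= 2 -> (0 < n)%N ->
  `|x| `^ h <= n%:R `^ (- (h / 2)) * (1 + n%:R * x ^+ 2).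
Proof.
move=> /andP[h0 h2] n0; have n0' : (0 : R) < n%:R by rewrite ltr0n.
have -> : `|x| `^ h = n%:R `^ (- (h / 2)) * (n%:R * x ^+ 2) `^ (h / 2).
  rewrite powRM ?sqr_ge0// ?ler0n// mulrA -powRD; last first.
    by rewrite (gt_eqF n0') implybT.
  rewrite addNr powRr0 mul1r -real_normK ?num_real//.
  by rewrite -powR_mulrn// -powRrM; congr (_ `^ _); field.
apply: ler_wpM2l; first exact: powR_ge0.
have : 0 <= n%:R * x ^+ 2 by rewrite mulr_ge0 ?sqr_ge0.
move: (n%:R * x ^+ 2) => y y0; have [y1|y1] := leP y 1.
  have : y `^ (h / 2) <= 1 `^ (h / 2) by rewrite ge0_ler_powR ?nnegrE//; lra.
  by rewrite powR1; lra.
have : y `^ (h / 2) <= y `^ 1 by rewrite ler_powR//; lra.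
by rewrite powRr1; lra.
Qed.

Lemma bernstein_error (T h L : R) (K : R -> R) (n : nat) (t : R) :
  0 < T -> 0 <= h <= 2 -> (0 < n)%N -> 0 <= t <= T ->
  (forall x y, 0 <= x <= T -> 0 <= y <= T -> `|K x - K y| <= L * (`|x - y| `^ h)) ->
  `|K t - bernstein T K n t| <= `|L| * (1 + T ^+ 2) * n%:R `^ (- (h / 2)).
Proof.
move=> T0 h02 n0 tT HK; have n0' : (0 : R) < n%:R by rewrite ltr0n.
have Tn0 : T != 0 by rewrite gt_eqF.
rewrite bernsteinE//; set a := t / T; set b := (T - t) / T.
case/andP : (tT) => t0 tT'.
have a0 : 0 <= a by rewrite divr_ge0// ltW.
have b0 : 0 <= b by rewrite divr_ge0 ?subr_ge0// ltW.
have ab : a + b = 1 by rewrite /a /b; field.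
have -> : K t - binom_mean a b n (fun k => K (T * k%:R / n%:R)) =
    binom_mean a b n (fun k => K t + -1 * K (T * k%:R / n%:R)).
  by rewrite binom_meanD binom_mean_cst// binom_meanZ mulN1r.
apply: (le_trans (ler_norm_binom_mean _ _ a0 b0)).
pose D : R := `|L| * n%:R `^ (- (h / 2)).
have D0 : 0 <= D by rewrite mulr_ge0// powR_ge0.
(* This is [powR_le_sqr] at [x = t - T k / n = - (T / n) (k - n a)]. The mean of the square is the
   variance [n a b], whose [n] cancels the [1 / n]. *)
apply: (@le_trans _ _ (binom_mean a b n
   (fun k => D + D * (T ^+ 2 / n%:R) * (k%:R - n%:R * a) ^+ 2))).
  apply: le_binom_mean => // k kn.
  have kT : 0 <= T * k%:R / n%:R <= T.
    by rewrite divr_ge0 ?mulr_ge0// ?(ltW T0)//= ler_pdivrMr// ler_pM2l// ler_nat.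
  rewrite mulN1r; apply: (le_trans (HK _ _ tT kT)).
  apply: (@le_trans _ _ (`|L| * (`|t - T * k%:R / n%:R| `^ h))).
    by apply: ler_wpM2r; [exact: powR_ge0|exact: ler_norm].
  have /(ler_wpM2l (normr_ge0 L)) := powR_le_sqr (t - T * k%:R / n%:R) h02 n0.
  move=> /le_trans; apply; rewrite [leLHS]mulrA -/D mulrDr mulr1 lerD2l -[leRHS]mulrA ler_wpM2l//.
  rewrite le_eqVlt; apply/orP; left; apply/eqP; rewrite /a; field.
  by rewrite Tn0 gt_eqF.
rewrite binom_meanD binom_mean_cst// binom_meanZ binom_mean_sqr// subrr expr0n addr0.
have -> : D * (T ^+ 2 / n%:R) * (n%:R * a * b) = D * T ^+ 2 * (a * b).
  by field; rewrite gt_eqF.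
have ab1 : a * b <= 1 by rewrite mulr_ile1//; lra.
have := ler_wpM2l (mulr_ge0 D0 (sqr_ge0 T)) ab1.
rewrite mulr1 => H; apply: (le_trans (lerD (lexx D) H)).
rewrite /D le_eqVlt; apply/orP; left; apply/eqP; ring.
Qed.

Lemma powRN_half_le1 (h : R) (n : nat) : 0 <= h -> (0 < n)%N ->
  n%:R `^ (- (h / 2)) <= 1 :> R.
Proof.
move=> h0 n0; rewrite powRN invf_le1 ?powR_gt0 ?ltr0n//.
rewrite -[leLHS](powRr0 n%:R); apply: ler_powR; last by rewrite divr_ge0.
by rewrite ler1n.
Qed.

End bernstein_error.

(** * Second moment of the normal distribution *)

Section normal_moment.
Context {R : realType}.
Notation mu := (@lebesgue_measure R).

(** The Radon-Nikodym derivative of [normal_prob] agrees almost everywhere with [normal_pdf], as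
    both have the same integral over every measurable set. *)
Lemma ge0_integral_normal_prob (m s : R) (f : measurableTypeR R -> \bar R) :
  measurable_fun setT f -> (forall x, 0 <= f x)%E ->
  (\int[normal_prob m s]_x f x = \int[mu]_x (f x * (normal_pdf m s x)%:E))%E.
Proof.
move=> mf f0; have dom := normal_prob_dominates m s.
rewrite -(Radon_Nikodym_SigmaFinite.change_of_variables dom)//.
have ifRN := Radon_Nikodym_SigmaFinite.f_integrable dom.
apply: ge0_ae_eq_integral => //.
- by apply: emeasurable_funM => //; exact: measurable_int ifRN.
- apply: emeasurable_funM => //; apply/measurable_EFinP.
  exact: measurable_normal_pdf.
- by move=> x _; rewrite mule_ge0// Radon_Nikodym_SigmaFinite.f_ge0.
- by move=> x _; rewrite mule_ge0// lee_fin normal_pdf_ge0.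
- apply: ae_eqe_mul2l; apply: integral_ae_eq => //.
    by apply/measurable_EFinP; exact: measurable_normal_pdf.
  by move=> E _ mE; rewrite -(Radon_Nikodym_SigmaFinite.f_integral dom).
Qed.

(** The variance of the standard normal law, kept symbolic: it reappears as the factor [c] in all
    later constants. *)
Definition normal_moment2 : \bar R := (\int[normal_prob 0 1]_x ((x : R) ^+ 2)%:E)%E.

Lemma measurable_fun_sqr (U : set R) : measurable_fun U (fun x : R => (x ^+ 2)%:E).
Proof. by apply/measurable_EFinP; exact: measurable_funX. Qed.

Lemma normal_moment2_lty : (normal_moment2 < +oo)%E.
Proof.
rewrite /normal_moment2 ge0_integral_normal_prob//; last 2 first.
- exact: measurable_fun_sqr.
- by move=> x; rewrite lee_fin sqr_ge0.
pose s : R := Num.sqrt 2.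
have s0 : s != 0 by rewrite gt_eqF// sqrtr_gt0.
have s2 : s ^+ 2 = 2 by rewrite sqr_sqrtr.
(* [x ^+ 2 / 4 <= exp (x ^+ 2 / 4)] bounds the integrand by a multiple of the
   density of variance 2. *)
pose c : R := 4 * normal_peak 1 / normal_peak s.
have c0 : 0 <= c by rewrite !mulr_ge0 ?normal_peak_ge0// invr_ge0 normal_peak_ge0.
apply: (@le_lt_trans _ _ (\int[mu]_x (c%:E * (normal_pdf 0 s x)%:E))%E).
  apply: ge0_le_integral => //.
  - by move=> x _; rewrite mule_ge0 ?lee_fin ?sqr_ge0 ?normal_pdf_ge0.
  - apply: emeasurable_funM; first exact: measurable_fun_sqr.
    by apply/measurable_EFinP; exact: measurable_normal_pdf.
  - apply: emeasurable_funM => //.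
    by apply/measurable_EFinP; exact: measurable_normal_pdf.
  move=> x _; rewrite -!EFinM lee_fin !normal_pdfE ?oner_eq0// /normal_fun.
  have -> : c * (normal_peak s * expR (- (x - 0) ^+ 2 / (s ^+ 2 *+ 2))) =
     normal_peak 1 * (4 * expR (- (x ^+ 2 / 4))).
    rewrite /c subr0 s2 (_ : - x ^+ 2 / (2 *+ 2) = - (x ^+ 2 / 4)); last by field.
    by field; rewrite gt_eqF// normal_peak_gt0.
  rewrite mulrCA; apply: ler_wpM2l; first exact: normal_peak_ge0.
  have -> : - (x - 0) ^+ 2 / (1 ^+ 2 *+ 2) = - (x ^+ 2 / 4) + - (x ^+ 2 / 4) :> R.
    by rewrite subr0 expr1n; field.
  rewrite expRD mulrA ler_wpM2r ?expR_ge0//.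
  have := expR_ge1Dx (x ^+ 2 / 4); rewrite expRN ler_pdivrMr ?expR_gt0//; lra.
rewrite ge0_integralZl//.
- by rewrite integral_normal_pdf mule1 ltry.
- by apply/measurable_EFinP; exact: measurable_normal_pdf.
- by move=> x _; rewrite lee_fin normal_pdf_ge0.
Qed.

Lemma normal_prob_moment2 (s : R) : 0 < s ->
  (\int[normal_prob 0 s]_x ((x : R) ^+ 2)%:E = (s ^+ 2)%:E * normal_moment2)%E.
Proof.
move=> s0; have sn0 : s != 0 by rewrite gt_eqF.
have sq0 (x : R) : (0 <= (x ^+ 2)%:E)%E by rewrite lee_fin sqr_ge0.
rewrite /normal_moment2 !ge0_integral_normal_prob//; try exact: measurable_fun_sqr.
have dF : derive1 (fun x : R => s * x) = cst s.
  by apply/funext => x; rewrite derive1E deriveM// derive_cst scaler0 addr0 derive_id scaler1.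
under eq_integral do rewrite -EFinM.
(* Under [x := s x] the Jacobian [s] cancels the [1 / s] in the peak of the density, and [x^2]
   contributes [s^2]. *)
rewrite (@increasing_ge0_integration_by_substitutionT R (fun x => s * x)
  (fun x => x ^+ 2 * normal_pdf 0 s x)) ?dF.
- rewrite -ge0_integralZl//; last 2 first.
  + apply: emeasurable_funM; first exact: measurable_fun_sqr.
    by apply/measurable_EFinP; exact: measurable_normal_pdf.
  + by move=> x _; rewrite mule_ge0 ?lee_fin ?sqr_ge0 ?normal_pdf_ge0.
  apply: eq_integral => x _; rewrite -!EFinM; congr EFin.
  rewrite !fctE/= !normal_pdfE ?oner_eq0// /normal_fun /normal_peak.
  have -> : - (s * x - 0) ^+ 2 / (s ^+ 2 *+ 2) = - (x - 0) ^+ 2 / (1 ^+ 2 *+ 2).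
    by rewrite !subr0 expr1n; field.
  have -> : s ^+ 2 * pi *+ 2 = s ^+ 2 * (1 ^+ 2 * pi *+ 2) :> R by ring.
  rewrite sqrtrM ?sqr_ge0// sqrtr_sqr gtr0_norm// invfM.
  field; rewrite sn0 andbT gt_eqF// sqrtr_gt0.
  by rewrite pmulrn_lgt0// mulr_gt0 ?pi_gt0// exprn_even_gt0.
- by move=> x y xy; rewrite ltr_pM2l.
- by move=> x; exact: cvg_cst.
- exact: is_cvg_cst.
- exact: is_cvg_cst.
- by move=> x; apply: derivableM.
- exact: gt0_cvgMrNy.
- exact: gt0_cvgMry.
- move=> x; apply: cvgM; last exact: continuous_normal_pdf.
  exact: sqr_continuous.
- by move=> x; rewrite mulr_ge0 ?sqr_ge0 ?normal_pdf_ge0.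
Qed.

End normal_moment.

(** * Gronwall's inequality *)

Section gronwall.
Context {R : realType}.
Notation mu := (@lebesgue_measure R).

Lemma continuous_expRM (k : R) : continuous (fun x : R => expR (k * x)).
Proof.
move=> x; apply: (@continuous_comp _ _ _ ( *%R k) expR); last exact: continuous_expR.
exact: mulrl_continuous.
Qed.

Lemma integral_expR_le (k t : R) : 0 < k -> 0 <= t ->
  (\int[mu]_(s in `[0%R, t]) (expR (k * s))%:E <= (expR (k * t) / k)%:E)%E.
Proof.
move=> k0; rewrite le_eqVlt => /predU1P[<-|t0].
  by rewrite set_itv1 integral_set1 lee_fin divr_ge0 ?expR_ge0 ?ltW.
pose F (x : R) : R := expR (k * x) / k.
have dF (x : R) : is_derive x 1 F (expR (k * x)).
  rewrite /F; apply: is_derive_eq.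
  by rewrite scaler0 add0r /GRing.scale/=; field; rewrite gt_eqF.
have cE := @continuous_expRM k.
have cF : continuous F by move=> x; apply: cvgM; [exact: cE|exact: cvg_cst].
rewrite (@continuous_FTC2 R (fun x => expR (k * x)) F 0 t t0).
- rewrite -EFinB lee_fin /F gerBl// mulr0 expR0 divr_ge0// ltW//.
- exact: continuous_subspaceT.
- split.
  + by move=> x _; apply: ex_derive.
  + by apply: cvg_at_right_filter; exact: cF.
  + by apply: cvg_at_left_filter; exact: cF.
- by move=> x _; rewrite derive1E; apply: derive_val.
Qed.

(** Stated for a merely measurable, integrable [phi] with extended values, as second moments come.
    The factors 2 before [A] and [B] are the price of arguing by contraction in a weighted
    supremum. *)
Lemma gronwall (T A B : R) (phi : R -> \bar R) :
  0 <= A -> 0 < B ->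
  measurable_fun `[0%R, T] phi ->
  (forall t, 0 <= t <= T -> (0 <= phi t)%E) ->
  (\int[mu]_(s in `[0%R, T]) phi s < +oo)%E ->
  (forall t, (0 <= t <= T)%R ->
     phi t <= A%:E + B%:E * \int[mu]_(s in `[0%R, t]) phi s)%E ->
  forall t, 0 <= t <= T -> (phi t <= (2 * A * expR (2 * B * T))%:E)%E.
Proof.
move=> A0 B0 mphi phi0 iphi Hphi.
have sub t : t <= T -> `[0, t] `<=` `[0, T].
  by move=> tT x /=; rewrite !in_itv/= => /andP[->/= /le_trans]; apply.
have phi0' t x : t <= T -> `[0, t]%classic x -> (0 <= phi x)%E.
  by move=> tT /(sub _ tT)/=; rewrite in_itv/= => /phi0.
have mphi' t : t <= T -> measurable_fun `[0, t] phi.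
  by move=> tT; apply: measurable_funS mphi => //; exact: sub.
have ifin : (\int[mu]_(s in `[0%R, T]) phi s \is a fin_num)%E.
  by rewrite ge0_fin_numE//; apply: integral_ge0 => x; exact: phi0'.
(* A crude bound, from the hypothesis with the integral taken over all of [[0, T]]; it makes [phi]
   real valued and the supremum below finite. *)
pose M := A + B * fine (\int[mu]_(s in `[0%R, T]) phi s)%E.
have phiM t : 0 <= t <= T -> (phi t <= M%:E)%E.
  move=> tT; apply: (le_trans (Hphi _ tT)); case/andP: tT => t0 tT.
  rewrite /M EFinD EFinM fineK// leeD2l// lee_wpmul2l ?lee_fin ?(ltW B0)//.
  apply: ge0_subset_integral => //; exact: sub.
pose f t := fine (phi t).
have fE t : 0 <= t <= T -> phi t = (f t)%:E.
  move=> tT; rewrite fineK// ge0_fin_numE ?phi0//.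
  by apply: (le_lt_trans (phiM _ tT)); rewrite ltry.
(* The weight [exp (- 2 B t)] turns integration into a contraction of factor
   [1 / 2], hence [S <= A + S / 2] for the weighted supremum [S]. *)
move=> t1 tT1; pose S := sup [set f t * expR (- (2 * B * t)) | t in `[0, T]].
have supS : has_sup [set f t * expR (- (2 * B * t)) | t in `[0, T]].
  split; first by exists (f t1 * expR (- (2 * B * t1))); exists t1 => //=; rewrite in_itv.
  exists M => _ [t /= + <-]; rewrite in_itv/= => tT.
  have ftM : f t <= M by rewrite -lee_fin -fE// phiM.
  have ft0 : 0 <= f t by rewrite -lee_fin -fE// phi0.
  apply: le_trans ftM; rewrite ler_piMr// -expR0 ler_expR oppr_le0.
  by case/andP: tT => t0 _; rewrite !mulr_ge0// ltW.
have fS t : 0 <= t <= T -> f t <= S * expR (2 * B * t).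
  move=> tT; rewrite -ler_pdivrMr ?expR_gt0// -expRN.
  by apply: ub_le_sup; [case: supS|exists t => //=; rewrite in_itv].
have S0 : 0 <= S.
  have := fS _ tT1; rewrite -ler_pdivrMr ?expR_gt0//; apply: le_trans.
  by rewrite divr_ge0 ?expR_ge0// -lee_fin -fE// phi0.
have fA t : 0 <= t <= T -> f t <= A + S / 2 * expR (2 * B * t).
  move=> tT; rewrite -lee_fin -fE//; apply: (le_trans (Hphi _ tT)).
  case/andP: (tT) => t0 tT'.
  rewrite EFinD leeD2l//.
  have -> : S / 2 * expR (2 * B * t) = B * (S * (expR (2 * B * t) / (2 * B))).
    by field; rewrite gt_eqF.
  rewrite EFinM lee_wpmul2l ?lee_fin ?(ltW B0)//.
  have mE : measurable_fun `[0, t] (fun s => (expR (2 * B * s))%:E).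
    apply/measurable_EFinP; apply: measurable_funTS; apply: continuous_measurable_fun.
    exact: continuous_expRM.
   apply: (@le_trans _ _ (\int[mu]_(s in `[0%R, t]) (S%:E * (expR (2 * B * s))%:E))%E).
    apply: ge0_le_integral => //.
    - by move=> x; exact: phi0'.
    - exact: mphi'.
    - by apply: emeasurable_funM.
    - move=> x /= /(sub _ tT'); rewrite /= in_itv/= => xT.
      by rewrite fE// -EFinM lee_fin fS.
  rewrite ge0_integralZl//.
  rewrite [leRHS]EFinM lee_wpmul2l ?lee_fin//; apply: integral_expR_le => //.
  by rewrite mulr_gt0.
have SA : S <= A + S / 2.
  apply: ge_sup; first by case: supS.
  move=> _ [t /= + <-]; rewrite in_itv/= => tT.
  rewrite expRN ler_pdivrMr ?expR_gt0//; apply: (le_trans (fA _ tT)).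
  rewrite [leRHS]mulrDl lerD2r ler_peMr// -expR0 ler_expR.
  by case/andP: tT => t0 _; rewrite !mulr_ge0// ltW.
have {SA} SA : S <= 2 * A by lra.
rewrite fE// lee_fin; apply: (le_trans (fS _ tT1)).
apply: ler_pM => //.
by rewrite ler_expR ler_wpM2l//; [rewrite mulr_ge0// ltW|case/andP: tT1].
Qed.

End gronwall.

(** * Brownian increments and Wiener integrals *)

Section means.
Context {R : realType} {d : measure_display} {Omega : measurableType d}.
Variable P : probability Omega R.

(** Integrability is bundled with the value so that linearity applies to the signed combinations
    produced by polarization. *)
Definition has_mean (f : Omega -> R) (v : R) :=
  P.-integrable setT (EFin \o f) /\ (\int[P]_w (f w)%:E = v%:E)%E.

Lemma has_meanZ (k : R) f v : has_mean f v -> has_mean (fun w => k * f w) (k * v).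
Proof.
move=> [fi fv]; split; first exact: (integrableZl _ k fi).
by under eq_integral do rewrite EFinM; rewrite integralZl// fv.
Qed.

Lemma has_meanD f g v v' :
  has_mean f v -> has_mean g v' -> has_mean (fun w => f w + g w) (v + v').
Proof.
move=> [fi fv] [gi gv]; split; first exact: (integrableD _ fi gi).
rewrite EFinD -fv -gv -integralD_EFin//.
Qed.

Lemma has_mean_sum (n : nat) (f : 'I_n -> Omega -> R) (v : 'I_n -> R) :
  (forall i, has_mean (f i) (v i)) ->
  has_mean (fun w => \sum_(i < n) f i w) (\sum_(i < n) v i).
Proof.
move=> fv.
have -> : (fun w => \sum_(i < n) f i w) = \sum_(i < n) f i.
  by apply/funext => w; rewrite fct_sumE.
elim/big_rec2: _ => [|i y g _ IH]; last exact: has_meanD.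
by split; [exact: integrable0|exact: integral0].
Qed.

End means.

Section brownian_increments.
Context {R : realType} {d : measure_display} {Omega : measurableType d}.
Variables (P : probability Omega R) (W : R -> Omega -> R).
Hypothesis BM : brownian_motion P W.
Let c : R := fine (@normal_moment2 R).

Lemma fin_normal_moment2 : (@normal_moment2 R) = c%:E.
Proof.
rewrite /c fineK// ge0_fin_numE ?normal_moment2_lty//.
by apply: integral_ge0 => x _; rewrite lee_fin sqr_ge0.
Qed.

Lemma fine_normal_moment2_ge0 : 0 <= c.
Proof. by apply/fine_ge0/integral_ge0 => x _; rewrite lee_fin sqr_ge0. Qed.

Lemma measurable_increment s t : 0 <= s -> 0 <= t ->
  measurable_fun setT (fun w => W t w - W s w).
Proof. by move=> s0 t0; case: BM => mW _ _ _; apply: measurable_funB; exact: mW. Qed.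

Lemma increment_moment2 s t : 0 <= s -> s <= t ->
  has_mean P (fun w => (W t w - W s w) ^+ 2) (c * (t - s)).
Proof.
move=> s0 st; have t0 := le_trans s0 st.
have mg := measurable_increment s0 t0.
suff E : (\int[P]_w ((W t w - W s w) ^+ 2)%:E = (c * (t - s))%:E)%E.
  split=> //; apply/integrableP; split.
    by apply/measurable_EFinP; exact: measurable_funX.
  under eq_integral do rewrite /= ger0_norm ?sqr_ge0//.
  by rewrite E ltry.
(* The law of an increment is prescribed only for [s < t]; the degenerate case is separate. *)
move: st; rewrite le_eqVlt => /predU1P[->|st].
  under eq_integral do rewrite subrr expr0n.
  by rewrite integral0 subrr mulr0.
have /= := @ge0_integral_pushforward _ _ _ (measurableTypeR R) R _ mg P setT
  (fun x : R => (x ^+ 2)%:E) measurableT (@measurable_fun_sqr R setT).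
rewrite preimage_setT => <-; last by move=> x _; rewrite lee_fin sqr_ge0.
rewrite (eq_measure_integral (normal_prob 0 (Num.sqrt (t - s)))).
  rewrite normal_prob_moment2 ?sqrtr_gt0 ?subr_gt0//.
  by rewrite sqr_sqrtr ?subr_ge0 ?(ltW st)// fin_normal_moment2 -EFinM mulrC.
move=> B mB _; case: BM => _ _ /(_ s t s0 st B mB) PB _.
rewrite [RHS](esym PB).
by rewrite /pushforward/=; congr (P _); apply/seteqP; split=> w /=; rewrite inE.
Qed.

Lemma abs_increment_moment2 s t : 0 <= s -> 0 <= t ->
  has_mean P (fun w => (W t w - W s w) ^+ 2) (c * `|t - s|).
Proof.
move=> s0 t0; have [st|/ltW ts] := leP s t.
  by rewrite ger0_norm ?subr_ge0//; exact: increment_moment2.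
rewrite distrC ger0_norm ?subr_ge0//.
have -> : (fun w => (W t w - W s w) ^+ 2) = (fun w => (W s w - W t w) ^+ 2).
  by apply/funext => w; rewrite -sqrrN opprB.
exact: increment_moment2.
Qed.

(* Polarization: the covariance of two increments is a linear combination of
   variances of increments, and it vanishes when they do not overlap. *)
Lemma increment_sum_moment2 (n : nat) (a : nat -> R) (tt : nat -> R) :
  0 <= tt 0%N -> {homo tt : i j / (i <= j)%N >-> i <= j} ->
  has_mean P (fun w => (\sum_(i < n) a i * (W (tt i.+1) w - W (tt i) w)) ^+ 2)
    (c * \sum_(i < n) a i ^+ 2 * (tt i.+1 - tt i)).
Proof.
move=> t00 tt_homo; have t0 i : 0 <= tt i by apply: le_trans t00 (tt_homo _ _ _).
pose D i j w := (W (tt j) w - W (tt i) w) ^+ 2.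
pose V i j := c * `|tt j - tt i|.
(* From [2 (q - p) (s - r) = (s - p)^2 + (r - q)^2 - (r - p)^2 - (s - q)^2]. The same combination is
   applied to the squares [D] and to their means [V]; off the diagonal the four distances in [V]
   cancel because [tt] is monotone. *)
pose br (F : nat -> nat -> R) i j :=
  a i * a j / 2 * (F i j.+1 + F i.+1 j + -1 * (F i j + F i.+1 j.+1)).
have mD i j : has_mean P (D i j) (V i j) by exact: abs_increment_moment2.
have -> : (fun w => (\sum_(i < n) a i * (W (tt i.+1) w - W (tt i) w)) ^+ 2) =
    fun w => \sum_(i < n) \sum_(j < n) br (fun i j => D i j w) i j.
  apply/funext => w; rewrite expr2 mulr_suml; apply: eq_bigr => i _.
  by rewrite mulr_sumr; apply: eq_bigr => j _; rewrite /br /D; field.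
have -> : c * (\sum_(i < n) a i ^+ 2 * (tt i.+1 - tt i)) =
    \sum_(i < n) \sum_(j < n) br V i j.
  rewrite mulr_sumr; apply: eq_bigr => i _; rewrite (bigD1 i)//= big1 ?addr0.
    rewrite /br /V !subrr normr0 (ger0_norm (x := tt i.+1 - tt i)); last first.
      by rewrite subr_ge0 tt_homo.
    rewrite distrC ger0_norm; last by rewrite subr_ge0 tt_homo.
    by field.
  move=> j ji; rewrite /br /V -!mulrDr mulrCA -mulrDr mulrCA.
  suff -> : `|tt j.+1 - tt i| + `|tt j - tt i.+1| +
      -1 * (`|tt j - tt i| + `|tt j.+1 - tt i.+1|) = 0 by rewrite !mulr0.
  have : (i != j :> nat) by rewrite eq_sym.
  rewrite neq_ltn => /orP[|] lt_ij.
    have h1 : tt i <= tt i.+1 by exact: tt_homo.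
    have h2 : tt i.+1 <= tt j by exact: tt_homo.
    have h3 : tt j <= tt j.+1 by exact: tt_homo.
    rewrite !ger0_norm; lra.
  have h1 : tt j <= tt j.+1 by exact: tt_homo.
  have h2 : tt j.+1 <= tt i by exact: tt_homo.
  have h3 : tt i <= tt i.+1 by exact: tt_homo.
  rewrite !ler0_norm; lra.
apply: has_mean_sum => i; apply: has_mean_sum => j.
by apply/has_meanZ/has_meanD; [|apply: has_meanZ]; exact: has_meanD.
Qed.

(** Both sums use one partition, so their difference is the sum for [f - g], and the variances of
    the increments add up to [c t]. The bound is free of [m], hence survives the limit. *)
Lemma riemann_sum_moment2_le (f g : R -> R) (t e : R) (m : nat) :
  0 <= t -> (0 < m)%N -> (forall s, 0 <= s <= t -> `|f s - g s| <= e) ->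
  (\int[P]_w ((\sum_(i < m) f (t * i%:R / m%:R) *
        (W (t * i.+1%:R / m%:R) w - W (t * i%:R / m%:R) w) -
      \sum_(i < m) g (t * i%:R / m%:R) *
        (W (t * i.+1%:R / m%:R) w - W (t * i%:R / m%:R) w)) ^+ 2)%:E
    <= (c * (e ^+ 2 * t))%:E)%E.
Proof.
move=> t0 m0 fge; have m0' : (0 : R) < m%:R by rewrite ltr0n.
pose tt (i : nat) : R := t * i%:R / m%:R.
pose a i := f (tt i) - g (tt i).
have [|i j ij|_ E] := @increment_sum_moment2 m a tt.
- by rewrite /tt mulr0 mul0r.
- by rewrite ler_pM2r ?invr_gt0// ler_wpM2l// ler_nat.
under eq_integral => w _.
  rewrite -sumrB; under eq_bigr => i _ do rewrite -mulrBl.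
  over.
rewrite E lee_fin; apply: ler_wpM2l; first exact: fine_normal_moment2_ge0.
apply: (@le_trans _ _ (\sum_(i < m) e ^+ 2 * (t / m%:R))).
  apply: ler_sum => i _.
  have -> : tt i.+1 - tt i = t / m%:R.
    by rewrite /tt -natr1; field; rewrite gt_eqF.
  apply: ler_wpM2r; first by rewrite divr_ge0// ltW.
  have ti : 0 <= tt i <= t.
    rewrite /tt divr_ge0 ?mulr_ge0 ?ler0n//= ler_pdivrMr// ler_wpM2l// ler_nat.
    exact: ltnW.
  by rewrite -real_normK ?num_real// lerXn2r ?nnegrE// ?(le_trans _ (fge _ ti))// fge.
rewrite sumr_const card_ord -mulr_natr le_eqVlt; apply/orP; left; apply/eqP.
by field; rewrite gt_eqF.
Qed.

Lemma measurable_riemann_sum (f : R -> R) (t : R) (m : nat) : 0 <= t ->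
  measurable_fun setT (fun w => \sum_(i < m) f (t * i%:R / m%:R) *
        (W (t * i.+1%:R / m%:R) w - W (t * i%:R / m%:R) w)).
Proof.
move=> t0; apply: measurable_sum => i; apply: measurable_funM => //.
by apply: measurable_increment; rewrite divr_ge0 ?mulr_ge0.
Qed.

(** Split [I - J = (I - Sf) + (Sf - Sg) + (Sg - J)] with the Riemann sums of [f] and [g]: the outer
    terms vanish in the limit, and 3 comes from [(p + q + r)^2 <= 3 (p^2 + q^2 + r^2)], proved by
    exhibiting the gap as a sum of squares. *)
Lemma wiener_integral_dist (f g : R -> R) (t e : R) (I J : Omega -> R) :
  0 <= t -> (forall s, 0 <= s <= t -> `|f s - g s| <= e) ->
  wiener_integral P W f t I -> wiener_integral P W g t J ->
  (\int[P]_w ((I w - J w) ^+ 2)%:E <= (3 * (c * (e ^+ 2 * t)))%:E)%E.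
Proof.
move=> t0 fge [mI cI] [mJ cJ].
set u := (X in X @ _ --> _) in cI; set v := (X in X @ _ --> _) in cJ.
suff le_m m : (0 < m)%N ->
    (\int[P]_w ((I w - J w) ^+ 2)%:E <= 3%:E * (u m + (c * (e ^+ 2 * t))%:E + v m))%E.
  have cR : (3%:E * (u m + (c * (e ^+ 2 * t))%:E + v m) @[m --> \oo] -->
      (3 * (c * (e ^+ 2 * t)))%:E)%E.
    rewrite [X in _ --> X]EFinM; apply: cvgeZl => //.
    rewrite -[X in _ --> X]add0e -[X in _ --> X]adde0.
    by apply: cvgeD => //; apply: cvgeD => //; exact: cvg_cst.
  apply: (cvge_to_ge cR); near=> m; apply: le_m.
  by near: m; exists 1%N.
move=> m0.
pose Sf w := \sum_(i < m) f (t * i%:R / m%:R) *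
        (W (t * i.+1%:R / m%:R) w - W (t * i%:R / m%:R) w).
pose Sg w := \sum_(i < m) g (t * i%:R / m%:R) *
        (W (t * i.+1%:R / m%:R) w - W (t * i%:R / m%:R) w).
have mSf : measurable_fun setT Sf by exact: measurable_riemann_sum.
have mSg : measurable_fun setT Sg by exact: measurable_riemann_sum.
have msq (F G : Omega -> R) : measurable_fun setT F -> measurable_fun setT G ->
    measurable_fun setT (fun w => ((F w - G w) ^+ 2)%:E).
  by move=> mF mG; apply/measurable_EFinP/measurable_funX/measurable_funB.
have sq0 (F G : Omega -> R) w : (0 <= ((F w - G w) ^+ 2)%:E)%E by rewrite lee_fin sqr_ge0.
apply: (@le_trans _ _ (\int[P]_w (3%:E * (((Sf w - I w) ^+ 2)%:E +
    ((Sf w - Sg w) ^+ 2)%:E + ((Sg w - J w) ^+ 2)%:E)))%E).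
  apply: ge0_le_integral => //; first exact: msq.
  - apply: emeasurable_funM => //; apply: emeasurable_funD; last exact: msq.
    by apply: emeasurable_funD; exact: msq.
  - move=> w _; rewrite -!EFinD -EFinM lee_fin -subr_ge0.
    have -> : 3 * ((Sf w - I w) ^+ 2 + (Sf w - Sg w) ^+ 2 + (Sg w - J w) ^+ 2) -
      (I w - J w) ^+ 2 = ((I w - Sf w) - (Sf w - Sg w)) ^+ 2 +
      ((Sf w - Sg w) - (Sg w - J w)) ^+ 2 + ((I w - Sf w) - (Sg w - J w)) ^+ 2 by ring.
    by rewrite !addr_ge0 ?sqr_ge0.
rewrite ge0_integralZl//; last 2 first.
- apply: emeasurable_funD; last exact: msq.
  by apply: emeasurable_funD; exact: msq.
- by move=> w _; rewrite !adde_ge0.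
rewrite lee_wpmul2l//.
rewrite ge0_integralD//; last 3 first.
- by move=> w _; rewrite adde_ge0.
- by apply: emeasurable_funD; exact: msq.
- exact: msq.
rewrite ge0_integralD//; [|exact: msq..].
apply: leeD => //; apply: leeD => //; exact: riemann_sum_moment2_le.
Unshelve. all: by end_near. Qed.

Lemma wiener_integral_moment2 (f : R -> R) (t e : R) (I : Omega -> R) :
  0 <= t -> (forall s, 0 <= s <= t -> `|f s| <= e) ->
  wiener_integral P W f t I ->
  (\int[P]_w ((I w) ^+ 2)%:E <= (3 * (c * (e ^+ 2 * t)))%:E)%E.
Proof.
move=> t0 fe wI.
(* Comparing with the zero integrand reduces the moment bound to the distance bound. *)
have w0 : wiener_integral P W (fun=> 0) t (fun=> 0).
  split=> //; apply: cvg_near_cst; near=> m.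
  apply: integral0_eq => w _; rewrite big1 ?subrr ?expr0n// => i _.
  by rewrite mul0r.
have := @wiener_integral_dist f (fun=> 0) t e I (fun=> 0) t0 _ wI w0.
under eq_integral do rewrite subr0.
by apply => s st; rewrite subr0 fe.
Unshelve. all: by end_near. Qed.

End brownian_increments.

(** * Square integrals and Tonelli's theorem on a strip *)

Section square_integrals.
Context {d : measure_display} {X : measurableType d} {R : realType}.
Variable nu : {measure set X -> \bar R}.
Implicit Types (D : set X) (f g : X -> R).

Lemma measurable_sqr_EFin D f : measurable_fun D f ->
  measurable_fun D (fun x => ((f x) ^+ 2)%:E).
Proof. by move=> mf; apply/measurable_EFinP/measurable_funX. Qed.

Lemma integral_sqr_ge0 D f : (0 <= \int[nu]_(x in D) ((f x) ^+ 2)%:E)%E.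
Proof. by apply: integral_ge0 => x _; rewrite lee_fin sqr_ge0. Qed.

(** Explicit coefficients let one estimate serve [alpha u - beta X], [X - Y] and the split drift. *)
Lemma integral_sqr_lin D f g (a b : R) : measurable D ->
  measurable_fun D f -> measurable_fun D g ->
  (\int[nu]_(x in D) ((a * f x + b * g x) ^+ 2)%:E <=
   (2 * a ^+ 2)%:E * \int[nu]_(x in D) ((f x) ^+ 2)%:E +
   (2 * b ^+ 2)%:E * \int[nu]_(x in D) ((g x) ^+ 2)%:E)%E.
Proof.
move=> mD mf mg.
have m2f := measurable_sqr_EFin mf; have m2g := measurable_sqr_EFin mg.
have sq0 h x : (0 <= ((h x) ^+ 2)%:E :> \bar R)%E by rewrite lee_fin sqr_ge0.
have a2 (k : R) : 0 <= 2 * k ^+ 2 by rewrite mulr_ge0 ?sqr_ge0.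
rewrite -!ge0_integralZl ?lee_fin//.
rewrite -ge0_integralD//; last 4 first.
- by move=> x _; rewrite mule_ge0 ?lee_fin ?sqr_ge0.
- exact: measurable_funeM.
- by move=> x _; rewrite mule_ge0 ?lee_fin ?sqr_ge0.
- exact: measurable_funeM.
apply: ge0_le_integral => //.
- apply: measurable_sqr_EFin; by apply: measurable_funD; apply: measurable_funM.
- by apply: emeasurable_funD; exact: measurable_funeM.
- move=> x _; rewrite -!EFinM -EFinD lee_fin -subr_ge0.
  rewrite (_ : _ - _ = (a * f x - b * g x) ^+ 2); first exact: sqr_ge0.
  ring.
Qed.

Lemma integrable_sqr D f : measurable D -> (nu D < +oo)%E -> measurable_fun D f ->
  (\int[nu]_(x in D) ((f x) ^+ 2)%:E < +oo)%E -> nu.-integrable D (EFin \o f).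
Proof.
move=> mD nuD mf f2; apply/integrableP; split; first exact/measurable_EFinP.
apply: (@le_lt_trans _ _ (\int[nu]_(x in D) (1%:E + ((f x) ^+ 2)%:E))%E).
  apply: ge0_le_integral => //.
  - by apply: measurableT_comp => //; exact/measurable_EFinP.
  - by apply: emeasurable_funD => //; exact: measurable_sqr_EFin.
  - move=> x _; rewrite /= -EFinD lee_fin.
    have := sqr_ge0 (`|f x| - 1); rewrite sqrrB real_normK ?num_real//.
    have := sqr_ge0 (f x); lra.
rewrite ge0_integralD//; last 2 first.
- by move=> x _; rewrite lee_fin sqr_ge0.
- exact: measurable_sqr_EFin.
by rewrite integral_cst// mul1e lte_add_pinfty.
Qed.

Lemma Rintegral_sqr_le D f : measurable D -> (nu D < +oo)%E ->
  nu.-integrable D (EFin \o f) ->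
  (((\int[nu]_(x in D) f x) ^+ 2)%:E <=
   nu D * \int[nu]_(x in D) ((f x) ^+ 2)%:E)%E.
Proof.
move=> mD nuD fi; have mf : measurable_fun D f.
  by apply/measurable_EFinP; exact: measurable_int fi.
have fD : nu D \is a fin_num by rewrite ge0_fin_numE.
pose l := fine (nu D); have lE : nu D = l%:E by rewrite fineK.
have l0 : 0 <= l by rewrite fine_ge0.
move: l0; rewrite le_eqVlt => /predU1P[l0|l0].
  have D0 : nu D = 0%E by rewrite lE -l0.
  rewrite /Rintegral null_set_integral// ?fine0 ?expr0n ?D0 ?mul0e//.
  exact/measurable_EFinP.
have [f2|f2] := ltP (\int[nu]_(x in D) ((f x) ^+ 2)%:E)%E +oo%E; last first.
  by move: f2; rewrite leye_eq => /eqP ->; rewrite lE gt0_muley ?lte_fin ?leey.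
(* With [m] the mean of [f], integrating [2 m f - m^2 <= f^2] gives Cauchy-Schwarz against the
   constant 1. *)
pose m := \int[nu]_(x in D) f x / l.
have i2 : nu.-integrable D (EFin \o (fun x => (f x) ^+ 2)).
  apply/integrableP; split; first exact: measurable_sqr_EFin.
  by under eq_integral do rewrite /= ger0_norm ?sqr_ge0//.
have i1 : nu.-integrable D (EFin \o (fun x => 2 * m * f x)).
  exact: (integrableZl _ (2 * m) fi).
have ic : nu.-integrable D (EFin \o (fun=> m ^+ 2)).
  apply/integrableP; split; first by apply/measurable_EFinP; exact: measurable_cst.
  rewrite (_ : integral _ _ _ = `|m ^+ 2|%:E * nu D)%E; last exact: integral_cst.
  by rewrite lE -EFinM ltry.
have := @le_Rintegral _ _ _ nu D (fun x => 2 * m * f x - m ^+ 2) (fun x => (f x) ^+ 2)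
  mD (integrableB mD i1 ic) i2.
rewrite RintegralB// RintegralZl// Rintegral_cst// -/l => H.
have {H} : 2 * m * \int[nu]_(x in D) f x - m ^+ 2 * l <= \int[nu]_(x in D) (f x ^+ 2).
  by apply: H => x _; have := sqr_ge0 (f x - m); rewrite sqrrB; lra.
rewrite /m (_ : _ - _ = (\int[nu]_(x in D) f x) ^+ 2 / l); last by field; rewrite gt_eqF.
rewrite ler_pdivrMr// mulrC => H.
by rewrite lE -[X in (_ <= _ * X)%E]fineK ?ge0_fin_numE ?integral_sqr_ge0// -EFinM lee_fin.
Qed.

End square_integrals.

Section strip.
Context {R : realType} {d : measure_display} {Omega : measurableType d}.
Variable P : probability Omega R.
Notation mu := (@lebesgue_measure R).

Lemma measurable_strip_time {d'} {Z : measurableType d'} (D : set R) (f : R -> Omega -> Z) w :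
  measurable D -> measurable_fun (D `*` setT) (fun p : R * Omega => f p.1 p.2) ->
  measurable_fun D (fun s => f s w).
Proof.
move=> mD mf; apply: (measurable_comp (F := D `*` setT)
  (f := fun p : R * Omega => f p.1 p.2) (g := fun s => (s, w))) => //.
- exact: measurableX.
- by move=> _ [s Ds <-]; split.
- exact/measurable_funTS/measurable_fun_pair.
Qed.

Lemma measurable_strip_omega {d'} {Z : measurableType d'} (D : set R) (f : R -> Omega -> Z) s :
  measurable D -> D s ->
  measurable_fun (D `*` setT) (fun p : R * Omega => f p.1 p.2) ->
  measurable_fun setT (f s).
Proof.
move=> mD Ds mf; apply: (measurable_comp (F := D `*` setT)
  (f := fun p : R * Omega => f p.1 p.2) (g := fun w => (s, w))) => //.
- exact: measurableX.
- by move=> _ [w _ <-]; split.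
- exact: measurable_fun_pair.
Qed.

Section tonelli.
Variables (D : set R) (f : R -> Omega -> \bar R).
Hypotheses (mD : measurable D) (f0 : forall s w, (0 <= f s w)%E).
Hypothesis mf : measurable_fun (D `*` setT) (fun p : R * Omega => f p.1 p.2).

(** Joint measurability is assumed only over [D]; extension by zero moves the problem to the full
    product space, where Tonelli's theorem applies. *)
Let F := (fun p : R * Omega => f p.1 p.2) \_ (D `*` setT).

Let mF : measurable_fun setT F.
Proof. by apply/(measurable_restrictT _ _).1 => //; exact: measurableX. Qed.

Let F0 p : (0 <= F p)%E.
Proof. by rewrite /F patchE; case: ifP. Qed.

Let FE s w : F (s, w) = ((f ^~ w) \_ D) s.
Proof. by rewrite /F !patchE in_setX/= (mem_set (I : [set: Omega] w)) andbT. Qed.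

Lemma strip_tonelli :
  (\int[P]_w \int[mu]_(s in D) f s w = \int[mu]_(s in D) \int[P]_w f s w)%E.
Proof.
have := @fubini_tonelli _ _ _ _ R mu P F mF F0 => swap.
under eq_integral do rewrite integral_mkcond.
transitivity (\int[P]_w \int[mu]_s F (s, w))%E.
  by apply: eq_integral => w _; apply: eq_integral => s _; rewrite FE.
rewrite -swap [RHS]integral_mkcond; apply: eq_integral => s _.
rewrite patchE; case: ifP => sD; last first.
  by apply: integral0_eq => w _; rewrite FE patchE sD.
by apply: eq_integral => w _; rewrite FE patchE sD.
Qed.

Lemma measurable_strip_integral_omega : measurable_fun D (fun s => \int[P]_w f s w)%E.
Proof.
have := measurable_fun_fubini_tonelli_F (m2 := P) F mF F0.
move=> /(measurable_funTS (D := D)); apply: eq_measurable_fun => s sD.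
by apply: eq_integral => w _; rewrite FE patchE sD.
Qed.

Lemma measurable_strip_integral_time :
  measurable_fun setT (fun w => \int[mu]_(s in D) f s w)%E.
Proof.
have := measurable_fun_fubini_tonelli_G (m1 := mu) F mF F0.
apply: eq_measurable_fun => w _; rewrite [RHS]integral_mkcond.
by apply: eq_integral => s _; rewrite FE.
Qed.

End tonelli.
End strip.

(** * Energies of processes and Gronwall's inequality for second moments *)

Section strip_estimates.
Context {R : realType} {d : measure_display} {Omega : measurableType d}.
Variable P : probability Omega R.
Notation mu := (@lebesgue_measure R).
Notation strip_fun D F := (measurable_fun (D `*` setT) (fun p : R * Omega => F p.1 p.2)).

Lemma strip_measurable_sqr_EFin (D : set R) (F : R -> Omega -> R) :
  strip_fun D F -> strip_fun D (fun s w => ((F s w) ^+ 2)%:E).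
Proof. exact: (@measurable_sqr_EFin _ _ _ _ (fun p => F p.1 p.2)). Qed.

Lemma strip_measurable_lin (D : set R) (F G : R -> Omega -> R) (a b : R) :
  strip_fun D F -> strip_fun D G -> strip_fun D (fun s w => a * F s w + b * G s w).
Proof. by move=> mF mG; apply: measurable_funD; apply: measurable_funM. Qed.

Lemma strip_measurable_energy (D : set R) (F : R -> Omega -> R) : measurable D ->
  strip_fun D F ->
  measurable_fun setT (fun w => \int[mu]_(s in D) ((F s w) ^+ 2)%:E)%E.
Proof.
move=> mD mF; apply: (measurable_strip_integral_time (f := fun s w => ((F s w) ^+ 2)%:E)) => //.
- by move=> s w; rewrite lee_fin sqr_ge0.
- exact: strip_measurable_sqr_EFin.
Qed.

Lemma strip_sqr_lin (D : set R) (F G : R -> Omega -> R) (a b : R) : measurable D ->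
  strip_fun D F -> strip_fun D G ->
  (\int[P]_w \int[mu]_(s in D) ((a * F s w + b * G s w) ^+ 2)%:E <=
   (2 * a ^+ 2)%:E * \int[P]_w \int[mu]_(s in D) ((F s w) ^+ 2)%:E +
   (2 * b ^+ 2)%:E * \int[P]_w \int[mu]_(s in D) ((G s w) ^+ 2)%:E)%E.
Proof.
move=> mD mF mG.
have a2 (k : R) : 0 <= 2 * k ^+ 2 by rewrite mulr_ge0 ?sqr_ge0.
have meF := strip_measurable_energy mD mF; have meG := strip_measurable_energy mD mG.
rewrite -!ge0_integralZl ?lee_fin//; try by move=> w _; exact: integral_sqr_ge0.
rewrite -ge0_integralD//; last 4 first.
- by move=> w _; rewrite mule_ge0 ?lee_fin ?a2 ?integral_sqr_ge0.
- exact: measurable_funeM.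
- by move=> w _; rewrite mule_ge0 ?lee_fin ?a2 ?integral_sqr_ge0.
- exact: measurable_funeM.
apply: ge0_le_integral => //.
- by move=> w _; exact: integral_sqr_ge0.
- apply: (strip_measurable_energy (F := fun s w => a * F s w + b * G s w)) => //.
  exact: strip_measurable_lin.
- by apply: emeasurable_funD; exact: measurable_funeM.
- by move=> w _; apply: integral_sqr_lin => //; exact: measurable_strip_time.
Qed.

(** Supplies, for almost every path, the finite energy that makes the drift integrable in the
    pathwise estimates. *)
Lemma ae_energy_lty (D : set R) (F : R -> Omega -> R) : measurable D -> strip_fun D F ->
  (\int[P]_w \int[mu]_(s in D) ((F s w) ^+ 2)%:E < +oo)%E ->
  {ae P, forall w, (\int[mu]_(s in D) ((F s w) ^+ 2)%:E < +oo)%E}.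
Proof.
move=> mD mF F2.
have iF : P.-integrable setT (fun w => \int[mu]_(s in D) ((F s w) ^+ 2)%:E)%E.
  apply/integrableP; split; first exact: strip_measurable_energy.
  by under eq_integral do rewrite gee0_abs ?integral_sqr_ge0//.
have := integrable_ae measurableT iF; apply: filterS => w /(_ I).
by rewrite ge0_fin_numE// integral_sqr_ge0.
Qed.

(** Common core of both Gronwall arguments. [V] is the forcing process ([u], then
    [alpha u - beta X]) and [J] the noise at time [t]. Taking expectations and exchanging integrals
    turns the pathwise bound into the hypothesis of [gronwall] for the second moment of [Y]. *)
Lemma second_moment_gronwall (T c a b k e v : R) (Y V : R -> Omega -> R) :
  0 <= c -> 0 <= a -> 0 <= b -> 0 < k -> 0 <= e -> 0 <= v ->
  strip_fun `[0, T] Y -> strip_fun `[0, T] V ->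
  (\int[P]_w \int[mu]_(s in `[0%R, T]) ((Y s w) ^+ 2)%:E < +oo)%E ->
  (\int[P]_w \int[mu]_(s in `[0%R, T]) ((V s w) ^+ 2)%:E <= e%:E)%E ->
  (forall t, 0 <= t <= T -> exists J : Omega -> R,
    [/\ measurable_fun setT J, (\int[P]_w ((J w) ^+ 2)%:E <= v%:E)%E &
    {ae P, forall w, (((Y t w) ^+ 2)%:E <=
      c%:E + a%:E * \int[mu]_(s in `[0%R, T]) ((V s w) ^+ 2)%:E + b%:E * ((J w) ^+ 2)%:E
      + k%:E * \int[mu]_(s in `[0%R, t]) ((Y s w) ^+ 2)%:E)%E}]) ->
  forall t, 0 <= t <= T ->
    (\int[P]_w ((Y t w) ^+ 2)%:E <= (2 * (c + a * e + b * v) * expR (2 * k * T))%:E)%E.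
Proof.
move=> c0 a0 b0 k0 e0 v0 mY mV Y2 V2 HY.
have mD (r : R) : measurable (`[0, r] : set R) by exact: measurable_itv.
have sY0 s w : (0 <= ((Y s w) ^+ 2)%:E)%E by rewrite lee_fin sqr_ge0.
have tonelli t : t <= T -> (\int[P]_w \int[mu]_(s in `[0%R, t]) ((Y s w) ^+ 2)%:E =
    \int[mu]_(s in `[0%R, t]) \int[P]_w ((Y s w) ^+ 2)%:E)%E.
  move=> tT; apply: (strip_tonelli P (f := fun s w => ((Y s w) ^+ 2)%:E)) => //.
  apply: strip_measurable_sqr_EFin; apply: measurable_funS mY; first exact: measurableX.
  by move=> [s w] /= []; rewrite !in_itv/= => /andP[-> /le_trans -> //].
have mYt t : t <= T -> strip_fun `[0, t] Y.
  move=> tT; apply: measurable_funS mY; first exact: measurableX.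
  by move=> [s w] /= []; rewrite !in_itv/= => /andP[-> /le_trans -> //].
apply: gronwall => //.
- by rewrite !addr_ge0 ?mulr_ge0.
- apply: (measurable_strip_integral_omega P (f := fun s w => ((Y s w) ^+ 2)%:E)) => //.
  exact: strip_measurable_sqr_EFin.
- by move=> t _; exact: integral_sqr_ge0.
- by rewrite -tonelli.
move=> t tT; have [J [mJ J2 HJ]] := HY t tT; case/andP : (tT) => t0 tT'.
have mJ2 := measurable_sqr_EFin mJ.
have mV2 := strip_measurable_energy (mD T) mV.
have mY2 := strip_measurable_energy (mD t) (mYt _ tT').
have eV0 (w : Omega) : (0 <= a%:E * \int[mu]_(s in `[0%R, T]) ((V s w) ^+ 2)%:E)%E.
  by rewrite mule_ge0 ?lee_fin ?integral_sqr_ge0.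
have eJ0 (w : Omega) : (0 <= b%:E * ((J w) ^+ 2)%:E)%E.
  by rewrite mule_ge0 ?lee_fin ?sqr_ge0.
have eY0 (w : Omega) : (0 <= k%:E * \int[mu]_(s in `[0%R, t]) ((Y s w) ^+ 2)%:E)%E.
  by rewrite mule_ge0 ?lee_fin ?(ltW k0) ?integral_sqr_ge0.
have mcV : measurable_fun setT (fun w => c%:E + a%:E * \int[mu]_(s in `[0%R, T]) ((V s w) ^+ 2)%:E)%E.
  by apply: emeasurable_funD => //; exact: measurable_funeM.
have mcVJ : measurable_fun setT (fun w => c%:E + a%:E * \int[mu]_(s in `[0%R, T]) ((V s w) ^+ 2)%:E
    + b%:E * ((J w) ^+ 2)%:E)%E.
  by apply: emeasurable_funD => //; exact: measurable_funeM.
have ecV w : (0 <= c%:E + a%:E * \int[mu]_(s in `[0%R, T]) ((V s w) ^+ 2)%:E)%E.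
  by rewrite adde_ge0 ?lee_fin.
have ecVJ w : (0 <= c%:E + a%:E * \int[mu]_(s in `[0%R, T]) ((V s w) ^+ 2)%:E
    + b%:E * ((J w) ^+ 2)%:E)%E by rewrite adde_ge0.
apply: (@le_trans _ _ (\int[P]_w
     (c%:E + a%:E * \int[mu]_(s in `[0%R, T]) ((V s w) ^+ 2)%:E + b%:E * ((J w) ^+ 2)%:E
      + k%:E * \int[mu]_(s in `[0%R, t]) ((Y s w) ^+ 2)%:E))%E).
  apply: ae_ge0_le_integral => //.
  - apply: measurable_sqr_EFin.
    apply: (measurable_strip_omega (D := `[0, T]) (f := Y)) => //.
  - by move=> w _; rewrite adde_ge0.
  - by apply: emeasurable_funD => //; exact: measurable_funeM.
  - apply: filterS HJ => w Hw _; exact: Hw.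
rewrite ge0_integralD//; last exact: measurable_funeM.
rewrite ge0_integralD//; last exact: measurable_funeM.
rewrite ge0_integralD//; last exact: measurable_funeM.
rewrite integral_cst//= probability_setT mule1.
rewrite !ge0_integralZl ?lee_fin ?(ltW k0)//; try by move=> w _; exact: integral_sqr_ge0.
  rewrite tonelli// !EFinD !EFinM leeD// leeD// ?leeD//; by rewrite lee_wpmul2l ?lee_fin.
by move=> w _; rewrite lee_fin sqr_ge0.
Qed.

End strip_estimates.

(** * Pathwise estimates for Volterra equations *)

Section paths.
Context {R : realType}.
Notation mu := (@lebesgue_measure R).

Lemma lebesgue_measure_segment_le (T t : R) : 0 <= t <= T -> (mu `[0%R, t] <= T%:E)%E.
Proof.
move=> /andP[t0 tT]; rewrite lebesgue_measure_itv/= lte_fin.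
by case: ltP => _; rewrite ?oppr0 ?adde0 lee_fin// (le_trans t0).
Qed.

Lemma subset_segment (T t : R) : 0 <= t <= T -> `[0, t] `<=` `[0, T].
Proof.
by move=> /andP[_ tT] s /=; rewrite !in_itv/= => /andP[-> /le_trans]; apply.
Qed.

Section kernel.
Variables (T t M : R) (G : R -> R).
Hypotheses (tT : 0 <= t <= T) (mG : measurable_fun `[0, T] G).
Hypothesis GM : forall s, 0 <= s <= T -> `|G s| <= M.

Lemma measurable_kernel : measurable_fun `[0, t] (fun s => G (t - s)).
Proof.
apply: (@measurable_comp _ _ _ (measurableTypeR R) (measurableTypeR R) (measurableTypeR R)
  `[0, T] G `[0, t] (fun s => t - s)) => //.
- move=> _ [s /= + <-]; rewrite !in_itv/= => /andP[s0 st]; case/andP: tT => t0 tT'.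
  by rewrite subr_ge0 st/= (le_trans _ tT')// gerBl.
- exact: measurable_funB.
Qed.

Lemma measurable_kernelM (v : R -> R) : measurable_fun `[0, t] v ->
  measurable_fun `[0, t] (fun s => G (t - s) * v s).
Proof. by move=> mv; apply: measurable_funM => //; exact: measurable_kernel. Qed.

Lemma kernel_energy_le (v : R -> R) : measurable_fun `[0, t] v ->
  (\int[mu]_(s in `[0%R, t]) ((G (t - s) * v s) ^+ 2)%:E <=
   (M ^+ 2)%:E * \int[mu]_(s in `[0%R, t]) ((v s) ^+ 2)%:E)%E.
Proof.
move=> mv; have mv2 := measurable_sqr_EFin mv.
rewrite -ge0_integralZl ?lee_fin ?sqr_ge0//; last by move=> s _; rewrite lee_fin sqr_ge0.
apply: ge0_le_integral => //.
- by move=> s _; rewrite lee_fin sqr_ge0.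
- by apply: measurable_sqr_EFin; exact: measurable_kernelM.
- exact: measurable_funeM.
move=> s /=; rewrite in_itv/= => /andP[s0 st]; case/andP: tT => t0 tT'.
have stT : 0 <= t - s <= T by rewrite subr_ge0 st/= (le_trans _ tT')// gerBl.
rewrite -EFinM lee_fin exprMn ler_wpM2r ?sqr_ge0//.
rewrite -real_normK ?num_real// lerXn2r ?nnegrE// ?GM//.
exact: le_trans (GM stT).
Qed.

Lemma integrable_kernelM (v : R -> R) : measurable_fun `[0, t] v ->
  (\int[mu]_(s in `[0%R, t]) ((v s) ^+ 2)%:E < +oo)%E ->
  mu.-integrable `[0, t] (fun s => (G (t - s) * v s)%:E).
Proof.
move=> mv v2; apply: (@integrable_sqr _ _ _ mu `[0, t] (fun s => G (t - s) * v s)) => //.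
- exact: (le_lt_trans (lebesgue_measure_segment_le tT) (ltry _)).
- exact: measurable_kernelM.
- apply: (le_lt_trans (kernel_energy_le mv)).
  by rewrite lte_mul_pinfty ?lee_fin ?sqr_ge0.
Qed.

End kernel.

Lemma Rintegral_itv_sqr_le (T t : R) (f : R -> R) : 0 <= t <= T ->
  mu.-integrable `[0, t] (EFin \o f) ->
  (((\int[mu]_(s in `[0, t]) f s) ^+ 2)%:E <=
    T%:E * \int[mu]_(s in `[0%R, t]) ((f s) ^+ 2)%:E)%E.
Proof.
move=> tT fi.
have mut := lebesgue_measure_segment_le tT.
have mutoo : (mu `[0%R, t] < +oo)%E := le_lt_trans mut (ltry _).
apply: le_trans (Rintegral_sqr_le _ mutoo fi) _ => //.
by apply: lee_wpmul2r => //; exact: integral_sqr_ge0.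
Qed.

(** Names the energies as reals, so that the pathwise estimates end in real arithmetic. *)
Lemma fin_energy_segment (T t : R) (v : R -> R) : 0 <= t <= T ->
  measurable_fun `[0, T] v ->
  (\int[mu]_(s in `[0%R, T]) ((v s) ^+ 2)%:E < +oo)%E ->
  exists a b : R, [/\ 0 <= a <= b,
    (\int[mu]_(s in `[0%R, t]) ((v s) ^+ 2)%:E = a%:E)%E &
    (\int[mu]_(s in `[0%R, T]) ((v s) ^+ 2)%:E = b%:E)%E].
Proof.
move=> tT mv v2.
have le_tT : (\int[mu]_(s in `[0%R, t]) ((v s) ^+ 2)%:E <=
    \int[mu]_(s in `[0%R, T]) ((v s) ^+ 2)%:E)%E.
  apply: ge0_subset_integral => //.
  - exact: measurable_sqr_EFin.
  - by move=> s _; rewrite lee_fin sqr_ge0.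
  - exact: subset_segment.
have f2 := le_lt_trans le_tT v2.
exists (fine (\int[mu]_(s in `[0%R, t]) ((v s) ^+ 2)%:E)),
  (fine (\int[mu]_(s in `[0%R, T]) ((v s) ^+ 2)%:E)).
split; [|by rewrite fineK// ge0_fin_numE ?integral_sqr_ge0..].
by rewrite fine_ge0 ?integral_sqr_ge0//= fine_le// ge0_fin_numE ?integral_sqr_ge0.
Qed.

(** The 3 comes from squaring three summands, the 6 from splitting the drift once more, and [T M^2]
    from Cauchy-Schwarz. The energy of [x] stops at [t], as Gronwall requires; that of [u] is
    enlarged to [[0, T]]. *)
Lemma volterra_path_sqr_le (T t M alpha beta sigma x0 i : R) (G u x : R -> R) :
  0 <= t <= T -> measurable_fun `[0, T] G ->
  (forall s, 0 <= s <= T -> `|G s| <= M) ->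
  measurable_fun `[0, T] u -> measurable_fun `[0, T] x ->
  (\int[mu]_(s in `[0%R, T]) ((u s) ^+ 2)%:E < +oo)%E ->
  (\int[mu]_(s in `[0%R, T]) ((x s) ^+ 2)%:E < +oo)%E ->
  (((x0 + \int[mu]_(s in `[0, t]) (G (t - s) * (alpha * u s - beta * x s))
      + sigma * i) ^+ 2)%:E <=
   (3 * x0 ^+ 2)%:E +
   (6 * T * M ^+ 2 * alpha ^+ 2)%:E * \int[mu]_(s in `[0%R, T]) ((u s) ^+ 2)%:E +
   (3 * sigma ^+ 2)%:E * (i ^+ 2)%:E +
   (6 * T * M ^+ 2 * beta ^+ 2)%:E * \int[mu]_(s in `[0%R, t]) ((x s) ^+ 2)%:E)%E.
Proof.
move=> tT mG GM mu_ mx u2 x2.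
have T0 : 0 <= T by case/andP: tT; exact: le_trans.
have [a [A [/andP[a0 aA] aE AE]]] := fin_energy_segment tT mu_ u2.
have [b [B [/andP[b0 bB] bE BE]]] := fin_energy_segment tT mx x2.
have mut : measurable_fun `[0, t] u by apply: measurable_funS mu_ => //; exact: subset_segment.
have mxt : measurable_fun `[0, t] x by apply: measurable_funS mx => //; exact: subset_segment.
pose v s := alpha * u s + - beta * x s.
have mv : measurable_fun `[0, t] v.
  by apply: measurable_funD; apply: measurable_funM.
have v2 := integral_sqr_lin mu alpha (- beta) (measurable_itv _) mut mxt.
rewrite aE bE -!EFinM -EFinD in v2.
have iv := integrable_kernelM tT mG GM mv (le_lt_trans v2 (ltry _)).
have := Rintegral_itv_sqr_le tT iv.
have -> : \int[mu]_(s in `[0, t]) (G (t - s) * (alpha * u s - beta * x s)) =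
    \int[mu]_(s in `[0, t]) (G (t - s) * v s).
  by apply: eq_Rintegral => s _; rewrite /v mulNr.
move: (\int[mu]_(s in `[0, t]) (G (t - s) * v s)) => r r2.
have {r2} : (((r ^+ 2)%:E <= T%:E * ((M ^+ 2)%:E *
    (2 * alpha ^+ 2 * a + 2 * (- beta) ^+ 2 * b)%:E))%E).
  apply: (le_trans r2); apply: lee_wpmul2l => //.
  apply: (le_trans (kernel_energy_le tT mG GM mv)).
  by apply: lee_wpmul2l => //; rewrite lee_fin sqr_ge0.
rewrite AE bE -!EFinM -!EFinD !lee_fin => r2.
(* [q] pays for enlarging the energy of [u]; the squares [h1], [h2], [h3] sum to the gap in the
   three-term inequality. *)
have q : 0 <= T * M ^+ 2 * alpha ^+ 2 * (A - a).
  by apply: mulr_ge0; [rewrite (mulr_ge0 (mulr_ge0 T0 (sqr_ge0 M)) (sqr_ge0 alpha))|rewrite subr_ge0].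
have h1 := sqr_ge0 (x0 - r); have h2 := sqr_ge0 (r - sigma * i).
have h3 := sqr_ge0 (x0 - sigma * i).
lra.
Qed.

Lemma volterra_paths_dist (T t M N e alpha beta sigma x0 i j : R) (G H u x y : R -> R) :
  0 <= t <= T -> measurable_fun `[0, T] G -> measurable_fun `[0, T] H ->
  (forall s, 0 <= s <= T -> `|G s| <= N) ->
  (forall s, 0 <= s <= T -> `|H s| <= M) ->
  (forall s, 0 <= s <= T -> `|G s - H s| <= e) ->
  measurable_fun `[0, T] u -> measurable_fun `[0, T] x -> measurable_fun `[0, T] y ->
  (\int[mu]_(s in `[0%R, T]) ((u s) ^+ 2)%:E < +oo)%E ->
  (\int[mu]_(s in `[0%R, T]) ((x s) ^+ 2)%:E < +oo)%E ->
  (\int[mu]_(s in `[0%R, T]) ((y s) ^+ 2)%:E < +oo)%E ->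
  (((x0 + \int[mu]_(s in `[0, t]) (G (t - s) * (alpha * u s - beta * x s))
      + sigma * i -
    (x0 + \int[mu]_(s in `[0, t]) (H (t - s) * (alpha * u s - beta * y s))
      + sigma * j)) ^+ 2)%:E <=
   (4 * T * e ^+ 2)%:E *
     \int[mu]_(s in `[0%R, T]) ((alpha * u s + - beta * x s) ^+ 2)%:E +
   (2 * sigma ^+ 2)%:E * ((i - j) ^+ 2)%:E +
   (4 * T * beta ^+ 2 * M ^+ 2)%:E *
     \int[mu]_(s in `[0%R, t]) ((1 * x s + -1 * y s) ^+ 2)%:E)%E.
Proof.
move=> tT mG mH GN HM GHe mu_ mx my u2 x2 y2.
have T0 : 0 <= T by case/andP: tT; exact: le_trans.
have lin2 (k l : R) (f g : R -> R) : measurable_fun `[0, T] f -> measurable_fun `[0, T] g ->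
    (\int[mu]_(s in `[0%R, T]) ((f s) ^+ 2)%:E < +oo)%E ->
    (\int[mu]_(s in `[0%R, T]) ((g s) ^+ 2)%:E < +oo)%E ->
    measurable_fun `[0, T] (fun s => k * f s + l * g s) /\
    (\int[mu]_(s in `[0%R, T]) ((k * f s + l * g s) ^+ 2)%:E < +oo)%E.
  move=> mf mg f2 g2; split.
    by apply: measurable_funD; apply: measurable_funM.
  apply: (le_lt_trans (integral_sqr_lin mu k l (measurable_itv _) mf mg)).
  by rewrite lte_add_pinfty// lte_mul_pinfty// lee_fin mulr_ge0 ?sqr_ge0.
pose v s := alpha * u s + - beta * x s; pose z s := alpha * u s + - beta * y s.
pose w s := 1 * x s + -1 * y s.
have [mv v2] : measurable_fun `[0, T] v /\
    (\int[mu]_(s in `[0%R, T]) ((v s) ^+ 2)%:E < +oo)%E by exact: lin2.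
have [mz z2] : measurable_fun `[0, T] z /\
    (\int[mu]_(s in `[0%R, T]) ((z s) ^+ 2)%:E < +oo)%E by exact: lin2.
have [mw w2] : measurable_fun `[0, T] w /\
    (\int[mu]_(s in `[0%R, T]) ((w s) ^+ 2)%:E < +oo)%E by exact: lin2.
rewrite -/(v _) -/(w _).
have [a [A [/andP[a0 aA] aE AE]]] := fin_energy_segment tT mv v2.
have [b [B [/andP[b0 bB] bE BE]]] := fin_energy_segment tT mw w2.
have [c [C [_ cE _]]] := fin_energy_segment tT mz z2.
have mS f : measurable_fun `[0, T] f -> measurable_fun `[0, t] (f : R -> R).
  by move=> mf; apply: measurable_funS mf => //; exact: subset_segment.
have iGv : mu.-integrable `[0, t] (fun s => (G (t - s) * v s)%:E).
  by apply: (integrable_kernelM tT mG GN); [exact: mS|rewrite aE ltry].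
have iHz : mu.-integrable `[0, t] (fun s => (H (t - s) * z s)%:E).
  by apply: (integrable_kernelM tT mH HM); [exact: mS|rewrite cE ltry].
have -> : \int[mu]_(s in `[0, t]) (G (t - s) * (alpha * u s - beta * x s)) =
    \int[mu]_(s in `[0, t]) (G (t - s) * v s).
  by apply: eq_Rintegral => s _; rewrite /v mulNr.
have -> : \int[mu]_(s in `[0, t]) (H (t - s) * (alpha * u s - beta * y s)) =
    \int[mu]_(s in `[0, t]) (H (t - s) * z s).
  by apply: eq_Rintegral => s _; rewrite /z mulNr.
have mI : measurable (`[0, t]%classic : set (measurableTypeR R)) by exact: measurable_itv.
have := Rintegral_itv_sqr_le (f := fun s => G (t - s) * v s - H (t - s) * z s)
  tT (integrableB mI iGv iHz).
rewrite (@RintegralB _ _ _ mu _ (fun s => G (t - s) * v s) (fun s => H (t - s) * z s))//.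
move: (\int[mu]_(s in `[0, t]) (G (t - s) * v s)) (\int[mu]_(s in `[0, t]) (H (t - s) * z s)).
move=> r q rq2.
have mGH : measurable_fun `[0, T] (fun s => G s - H s) by exact: measurable_funB.
have {rq2} : ((((r - q) ^+ 2)%:E <= T%:E * ((2 * 1 ^+ 2)%:E * ((e ^+ 2)%:E * a%:E) +
    (2 * (- beta) ^+ 2)%:E * ((M ^+ 2)%:E * b%:E)))%E).
  apply: (le_trans rq2); apply: lee_wpmul2l => //.
  (* Since [v - z = - beta w], [G v - H z = (G - H) v - beta H w]: a small kernel acts on [v], and a
     bounded one on the difference [w] of the paths. *)
  rewrite (eq_integral (fun s : measurableTypeR R => ((1 * ((G (t - s) - H (t - s)) * v s) +
      - beta * (H (t - s) * w s)) ^+ 2)%:E)); last first.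
    by move=> s _; congr (_ ^+ 2)%:E; rewrite /v /z /w; ring.
  apply: (le_trans (integral_sqr_lin mu 1 (- beta) (measurable_itv _) _ _)).
  - exact: (measurable_kernelM tT mGH (mS _ mv)).
  - exact: (measurable_kernelM tT mH (mS _ mw)).
  rewrite -aE -bE; apply: leeD; apply: lee_wpmul2l.
  - by rewrite lee_fin mulr_ge0 ?sqr_ge0.
  - exact: (kernel_energy_le tT mGH GHe (mS _ mv)).
  - by rewrite lee_fin mulr_ge0 ?sqr_ge0.
  - exact: (kernel_energy_le tT mH HM (mS _ mw)).
rewrite AE bE -!EFinM -!EFinD !lee_fin => r2.
have p : 0 <= T * e ^+ 2 * (A - a).
  by apply: mulr_ge0; [rewrite (mulr_ge0 T0 (sqr_ge0 e))|rewrite subr_ge0].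
have h1 := sqr_ge0 ((r - q) - sigma * (i - j)).
lra.
Qed.

End paths.

(** * The error estimate *)

(* [sqr_ge0] comes first because [x ^+ 2] is convertible to [x * x], so that
   [mulr_ge0] would apply to it. *)
Ltac nonneg := by do ?[exact: sqr_ge0|exact: expR_ge0|assumption|apply: ltW; assumption|done
  |apply: mulr_ge0|apply: addr_ge0].

(** * Measurability and boundedness of Hoelder kernels *)

Section holder_kernel.
Context {R : realType}.
Variables (T h L : R) (K : R -> R).
Hypotheses (T0 : 0 < T) (h0 : 0 < h).
Hypothesis HK : forall x y, 0 <= x <= T -> 0 <= y <= T ->
  `|K x - K y| <= L * (`|x - y| `^ h).

Lemma holder_measurable : measurable_fun `[0, T] K.
Proof.
apply: subspace_continuous_measurable_fun => //.
apply/subspace_continuousP => x /=; rewrite in_itv/= => xT.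
apply/cvgrPdist_le => e e0.
(* Solves [(|L| + 1) r^h = e]; the [+ 1] covers [L = 0]. *)
pose r := (e / (`|L| + 1)) `^ h^-1.
have L0 : 0 < `|L| + 1 by rewrite ltr_wpDl.
have r0 : 0 < r by apply: powR_gt0; exact: divr_gt0.
have : \forall y \near x, `|x - y| < r by exact: (@cvgr_dist_lt _ _ _ (nbhs x) _ id x).
rewrite /prop_near1 /within/=; apply: filterS => y xy; rewrite in_itv/= => yT.
apply: (le_trans (HK xT yT)).
apply: (@le_trans _ _ ((`|L| + 1) * `|x - y| `^ h)).
  apply: ler_wpM2r; first exact: powR_ge0.
  by rewrite (le_trans (ler_norm L))// lerDl.
rewrite -ler_pdivlMl// mulrC.
have -> : e / (`|L| + 1) = r `^ h.
  by rewrite -powRrM mulVf ?gt_eqF// powRr1// divr_ge0 ?ltW.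
by rewrite ge0_ler_powR ?nnegrE// ltW.
Qed.

Lemma holder_bounded s : 0 <= s <= T -> `|K s| <= `|K 0| + `|L| * T `^ h.
Proof.
move=> sT; case/andP: (sT) => s0 sT'.
have T00 : 0 <= (0 : R) <= T by apply/andP; split=> //; exact: ltW.
rewrite -[K s](subrK (K 0)) addrC (le_trans (ler_normD _ _))// lerD2l.
apply: (le_trans (HK sT T00)); rewrite subr0 ger0_norm//.
apply: (@le_trans _ _ (`|L| * s `^ h)).
  by apply: ler_wpM2r; [exact: powR_ge0|exact: ler_norm].
by apply: ler_wpM2l => //; rewrite ge0_ler_powR ?nnegrE// ltW.
Qed.

End holder_kernel.

Lemma measurable_bernstein (R : realType) (T : R) (K : R -> R) (n : nat) (D : set R) :
  measurable_fun D (bernstein T K n).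
Proof.
apply: measurable_funM => //; apply: measurable_sum => k.
apply: measurable_funM.
  by apply: measurable_funM => //; exact: measurable_funX.
by apply: measurable_funX; exact: measurable_funB.
Qed.

Section energy_bound.
Context {R : realType} {d : measure_display} {Omega : measurableType d}.
Variable P : probability Omega R.
Notation mu := (@lebesgue_measure R).

Lemma energy_le_sup (T b : R) (F : R -> Omega -> R) : 0 <= T -> 0 <= b ->
  measurable_fun (`[0, T] `*` setT) (fun p : R * Omega => F p.1 p.2) ->
  (forall t, 0 <= t <= T -> (\int[P]_w ((F t w) ^+ 2)%:E <= b%:E)%E) ->
  (\int[P]_w \int[mu]_(s in `[0%R, T]) ((F s w) ^+ 2)%:E <= (T * b)%:E)%E.
Proof.
move=> T0 b0 mF Fb.
have F0 s w : (0 <= ((F s w) ^+ 2)%:E)%E by rewrite lee_fin sqr_ge0.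
have mF2 := strip_measurable_sqr_EFin mF.
have mD : measurable (`[0, T]%classic : set R) by exact: measurable_itv.
rewrite (strip_tonelli P mD F0 mF2).
apply: (@le_trans _ _ (\int[mu]_(s in `[0%R, T]) cst b%:E s)%E).
  apply: ge0_le_integral => //.
  - by move=> s _; exact: integral_sqr_ge0.
  - exact: (measurable_strip_integral_omega P mD F0 mF2).
rewrite integral_cst// mulrC EFinM; apply: lee_wpmul2l => //.
by apply: lebesgue_measure_segment_le; rewrite T0 lexx.
Qed.

End energy_bound.

(** * Second moments of a solution and of the difference of two solutions *)

Section volterra_moments.
Context {R : realType} {d : measure_display} {Omega : measurableType d}.
Variables (P : probability Omega R) (W : R -> Omega -> R).
Hypothesis BM : brownian_motion P W.
Variables (T alpha beta sigma X0 : R).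
Hypotheses (T0 : 0 < T) (beta0 : 0 < beta).
Let c : R := fine (@normal_moment2 R).

Lemma volterra_second_moment (M N : R) (G : R -> R) (u X : R -> Omega -> R) :
  0 < M -> 0 <= N -> measurable_fun `[0, T] G -> (forall s, 0 <= s <= T -> `|G s| <= M) ->
  L2a P W T u -> (L2norm2 P T u <= N%:E)%E ->
  volterra_solution P W T alpha beta sigma X0 G u X ->
  forall t, 0 <= t <= T -> (\int[P]_w ((X t w) ^+ 2)%:E <=
    (2 * (3 * X0 ^+ 2 + 6 * T * M ^+ 2 * alpha ^+ 2 * N +
       3 * sigma ^+ 2 * (3 * (c * (M ^+ 2 * T)))) *
     expR (2 * (6 * T * M ^+ 2 * beta ^+ 2) * T))%:E)%E.
Proof.
move=> M0 N0 mG GM [mu_ _ u2] uN [[mX _ X2] HX].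
have c0 : 0 <= c := fine_normal_moment2_ge0.
have mD : measurable (`[0, T]%classic : set R) by exact: measurable_itv.
apply: (second_moment_gronwall (V := u)) => //.
- nonneg.
- nonneg.
- nonneg.
- by rewrite ?mulr_gt0 ?exprn_gt0.
- nonneg.
move=> t tT; have [I [wI XE]] := HX t tT; case/andP: (tT) => t0 tT'.
exists I; split; first by case: wI.
- apply: (le_trans (wiener_integral_moment2 BM (e := M) t0 _ wI)).
    move=> s /andP[s0 st]; apply: GM.
    by rewrite subr_ge0 st/= (le_trans _ tT')// gerBl.
  by rewrite lee_fin -/c ler_wpM2l// ler_wpM2l// ler_wpM2l ?sqr_ge0.
- apply: filterS3 XE (ae_energy_lty mD mu_ u2) (ae_energy_lty mD mX X2) => w -> uw xw.
  by apply: volterra_path_sqr_le => //; exact: measurable_strip_time.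
Qed.

Lemma volterra_dist (M N eps e2 : R) (G H : R -> R) (u X Y : R -> Omega -> R) :
  0 < M -> 0 <= eps -> 0 <= e2 ->
  measurable_fun `[0, T] G -> measurable_fun `[0, T] H ->
  (forall s, 0 <= s <= T -> `|G s| <= N) ->
  (forall s, 0 <= s <= T -> `|H s| <= M) ->
  (forall s, 0 <= s <= T -> `|G s - H s| <= eps) ->
  L2a P W T u ->
  volterra_solution P W T alpha beta sigma X0 G u X ->
  volterra_solution P W T alpha beta sigma X0 H u Y ->
  (\int[P]_w \int[lebesgue_measure]_(s in `[0%R, T])
     ((alpha * u s w + - beta * X s w) ^+ 2)%:E <= e2%:E)%E ->
  forall t, 0 <= t <= T -> (\int[P]_w ((X t w - Y t w) ^+ 2)%:E <=
    (2 * (4 * T * eps ^+ 2 * e2 + 2 * sigma ^+ 2 * (3 * (c * (eps ^+ 2 * T)))) *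
     expR (2 * (4 * T * beta ^+ 2 * M ^+ 2) * T))%:E)%E.
Proof.
move=> M0 eps0 e20 mG mH GN HM GH [mu_ _ u2] [[mX _ X2] HX] [[mY _ Y2] HY] V2 t tT.
have c0 : 0 <= c := fine_normal_moment2_ge0.
have mD : measurable (`[0, T]%classic : set R) by exact: measurable_itv.
pose D s w := 1 * X s w + -1 * Y s w.
have -> : (\int[P]_w ((X t w - Y t w) ^+ 2)%:E = \int[P]_w ((D t w) ^+ 2)%:E)%E.
  by apply: eq_integral => w _; rewrite /D mul1r mulN1r.
(* The initial values cancel in [X - Y], so the constant term [c] of [second_moment_gronwall] is
   0. *)
rewrite -[4 * T * eps ^+ 2 * e2]add0r.
pose V s w := alpha * u s w + - beta * X s w.
move: t tT; apply: (second_moment_gronwall (c := 0) (a := 4 * T * eps ^+ 2)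
  (b := 2 * sigma ^+ 2) (k := 4 * T * beta ^+ 2 * M ^+ 2) (e := e2)
  (v := 3 * (c * (eps ^+ 2 * T))) (Y := D) (V := V)).
- by [].
- nonneg.
- nonneg.
- by rewrite ?mulr_gt0 ?exprn_gt0.
- by [].
- nonneg.
- exact: strip_measurable_lin.
- exact: strip_measurable_lin.
- apply: le_lt_trans; first exact: (strip_sqr_lin P 1 (-1) mD mX mY).
  apply: lte_add_pinfty; apply: lte_mul_pinfty.
  + by rewrite lee_fin mulr_ge0 ?sqr_ge0.
  + by [].
  + exact: X2.
  + by rewrite lee_fin mulr_ge0 ?sqr_ge0.
  + by [].
  + exact: Y2.
- exact: V2.
move=> t tT; case/andP: (tT) => t0 tT'.
have [I [wI XE]] := HX t tT; have [J [wJ YE]] := HY t tT.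
exists (fun w => I w - J w); split.
- by case: wI => mI _; case: wJ => mJ _; exact: measurable_funB.
- apply: (le_trans (wiener_integral_dist BM (e := eps) t0 _ wI wJ)).
    move=> s /andP[s0 st]; apply: GH.
    by rewrite subr_ge0 st/= (le_trans _ tT')// gerBl.
  by rewrite lee_fin -/c ler_wpM2l// ler_wpM2l// ler_wpM2l ?sqr_ge0.
apply: filter_app (ae_energy_lty mD mY Y2); apply: filter_app YE.
apply: filterS3 XE (ae_energy_lty mD mu_ u2) (ae_energy_lty mD mX X2) => w Xw uw xw Yw yw.
rewrite /D mul1r mulN1r Xw Yw add0e.
by apply: (volterra_paths_dist (N := N)) => //; exact: measurable_strip_time.
Qed.

End volterra_moments.

Theorem theorem3p1 (R : realType) (d : measure_display) (Omega : measurableType d)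
  (P : probability Omega R) (W : R -> Omega -> R)
  (T alpha beta sigma X0 h : R) (K : R -> R) :
  0 < T -> 0 < alpha -> 0 < beta -> 0 < sigma ->
  brownian_motion P W ->
  0 < h < 1 -> holder_on T h K ->
  exists C : R, 0 < C /\
    forall (n : nat) (u Xu Xun : R -> Omega -> R), (0 < n)%N ->
      L2a P W T u ->
      volterra_solution P W T alpha beta sigma X0 K u Xu ->
      volterra_solution P W T alpha beta sigma X0 (bernstein T K n) u Xun ->
      forall t, 0 <= t <= T ->
        (\int[P]_w ((Xu t w - Xun t w) ^+ 2)%:E
          <= C%:E * (1 + L2norm2 P T u) * (n%:R `^ (- h))%:E)%E.
Proof.
move=> T0 alpha0 beta0 sigma0 BM /andP[h0 h1] [L HK].
have h02 : 0 <= h <= 2 by lra.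
pose c : R := fine (@normal_moment2 R); have c0 : 0 <= c := fine_normal_moment2_ge0.
pose E0 := `|L| * (1 + T ^+ 2).
have E00 : 0 <= E0 by rewrite mulr_ge0// addr_ge0// sqr_ge0.
(* Bounds [K] by its Hoelder estimate and [K_n] by adding the error, at most [E0]; the [+ 1] makes
   [M] positive, so that the Gronwall rates are too. *)
pose M := `|K 0| + `|L| * T `^ h + E0 + 1.
have M0 : 0 < M by rewrite ltr_wpDl// !addr_ge0// mulr_ge0// powR_ge0.
have KM s : 0 <= s <= T -> `|K s| <= M.
  by move=> sT; apply: (le_trans (holder_bounded T0 h0 HK sT)); rewrite /M; lra.
(* Times [1 + N], with [N] the squared norm of [u], [A1] bounds the second moment of [X], [A2] the
   energy of [alpha u - beta X], and [A3 eps^2] the final error. *)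
pose A1 := 2 * (3 * X0 ^+ 2 + 6 * T * M ^+ 2 * alpha ^+ 2 +
  3 * sigma ^+ 2 * (3 * (c * (M ^+ 2 * T)))) *
  expR (2 * (6 * T * M ^+ 2 * beta ^+ 2) * T).
have p1 : 0 <= 3 * X0 ^+ 2 by nonneg.
have p2 : 0 <= 6 * T * M ^+ 2 * alpha ^+ 2 by nonneg.
have p3 : 0 <= 3 * sigma ^+ 2 * (3 * (c * (M ^+ 2 * T))) by nonneg.
have A10 : 0 <= A1 by rewrite /A1; nonneg.
pose A2 := 2 * alpha ^+ 2 + 2 * beta ^+ 2 * (T * A1).
have A20 : 0 <= A2 by rewrite /A2; nonneg.
pose A3 := 2 * (4 * T * A2 + 2 * sigma ^+ 2 * (3 * (c * T))) *
  expR (2 * (4 * T * beta ^+ 2 * M ^+ 2) * T).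
have A30 : 0 <= A3 by rewrite /A3; nonneg.
(* The [+ 1] keeps the constant positive even when [L = 0], where [E0] vanishes. *)
exists (A3 * E0 ^+ 2 + 1); split; first by rewrite ltr_wpDl//; nonneg.
move=> n u X Y n0 uL HX HY t tT.
have [mu_ _ u2] := uL; have [[mX _ X2] _] := HX.
have mD : measurable (`[0, T]%classic : set R) by exact: measurable_itv.
have uge0 : (0 <= L2norm2 P T u)%E.
  by apply: integral_ge0 => w _; exact: integral_sqr_ge0.
pose N := fine (L2norm2 P T u).
have uE : L2norm2 P T u = N%:E.
  by rewrite /N fineK//; rewrite (ge0_fin_numE uge0); exact: u2.
have N0 : 0 <= N by rewrite fine_ge0.
pose p := n%:R `^ (- (h / 2)) : R.
have p0 : 0 <= p by exact: powR_ge0.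
have p1' : p <= 1 by apply: powRN_half_le1 => //; exact: ltW.
have pp : n%:R `^ (- h) = p ^+ 2.
  by rewrite /p -powR_mulrn ?powR_ge0// -powRrM; congr (_ `^ _); field.
have err s : 0 <= s <= T -> `|K s - bernstein T K n s| <= E0 * p.
  by move=> sT; exact: bernstein_error HK.
have BM_le s : 0 <= s <= T -> `|bernstein T K n s| <= M.
  move=> sT; have := err s sT; have := holder_bounded T0 h0 HK sT.
  have : E0 * p <= E0 by rewrite ler_piMr.
  have := ler_normB (K s) (K s - bernstein T K n s).
  by rewrite subKr /M; lra.
have mK := holder_measurable h0 HK.
have N1 : 1 <= 1 + N by rewrite lerDl.
have X2le s : 0 <= s <= T -> (\int[P]_w ((X s w) ^+ 2)%:E <= (A1 * (1 + N))%:E)%E.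
  move=> sT.
  apply: (le_trans (volterra_second_moment BM T0 beta0 M0 N0 mK KM uL _ HX sT)).
    by rewrite uE.
  rewrite lee_fin /A1 [leRHS]mulrAC ler_wpM2r ?expR_ge0// -[leRHS]mulrA ler_wpM2l//.
  rewrite -/c mulrDr mulr1.
  have := mulr_ge0 p1 N0; have := mulr_ge0 p3 N0.
  move: p1 p2 p3; move: (3 * X0 ^+ 2) (_ * alpha ^+ 2) (_ * (3 * _)) => x y z.
  lra.
have V2 : (\int[P]_w \int[lebesgue_measure]_(s in `[0%R, T])
     ((alpha * u s w + - beta * X s w) ^+ 2)%:E <= (A2 * (1 + N))%:E)%E.
  apply: (le_trans (strip_sqr_lin P alpha (- beta) mD mu_ mX)).
  have A1N : 0 <= A1 * (1 + N) by rewrite mulr_ge0// addr_ge0.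
  have XT := energy_le_sup (ltW T0) A1N mX X2le.
  apply: (@le_trans _ _ ((2 * alpha ^+ 2)%:E * N%:E +
     (2 * (- beta) ^+ 2)%:E * (T * (A1 * (1 + N)))%:E)%E).
    apply: leeD; first by rewrite -uE.
    by apply: lee_wpmul2l => //; rewrite lee_fin mulr_ge0 ?sqr_ge0.
  rewrite -!EFinM -EFinD lee_fin /A2 sqrrN.
  have := sqr_ge0 alpha; lra.
have e20 : 0 <= A2 * (1 + N) by nonneg.
have ep0 : 0 <= E0 * p by nonneg.
apply: (le_trans (volterra_dist BM T0 beta0 M0 ep0 e20 mK
  (@measurable_bernstein R T K n _) KM BM_le err uL HX HY V2 tT)).
rewrite uE pp -EFinD -!EFinM lee_fin -/c.
apply: (@le_trans _ _ (A3 * E0 ^+ 2 * (1 + N) * p ^+ 2)); last first.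
  rewrite ler_wpM2r ?sqr_ge0// ler_wpM2r ?addr_ge0//; lra.
have -> : A3 * E0 ^+ 2 * (1 + N) * p ^+ 2 =
    2 * (4 * T * (E0 * p) ^+ 2 * (A2 * (1 + N)) +
     2 * sigma ^+ 2 * (3 * (c * ((E0 * p) ^+ 2 * T))) * (1 + N)) *
     expR (2 * (4 * T * beta ^+ 2 * M ^+ 2) * T) by rewrite /A3; ring.
(* The noise term of [volterra_dist] does not involve [u]; [1 <= 1 + N] gives it the common
   factor. *)
rewrite ler_wpM2r ?expR_ge0// ler_wpM2l// lerD2l ler_peMr//.
nonneg.
Qed.
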